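(* Let $r,n,s,f,A$ be integers with $n>0$, $r\geq 0$ and $f(r-s)\equiv 0 \bmod n$, and let $G$ be the cyclically presented group in class $\mathfrak{M}$ determined by $(r,n,s,f,A)$. Suppose that $(r,s)=1$ and that $\mu=|r^{n/(n,A)}-s^{n/(n,A)}|\neq 0$. Let \[\bar{G}=B\left(\frac{(n,f)\mu}{n},\ \frac{n(n,A,f)}{(n,A)(n,f)},\ (s\hat{r})^{f\bar{\alpha}/(n,A,f)},\ 1\right)\] where $r\hat{r}\equiv 1 \bmod \mu$ and $\alpha\bar{\alpha}\equiv 1 \bmod n/(n,A)$ with $\alpha=A/(n,A)$. Then $G$ is a free product of $(n,A,f)$ copies of $\bar{G}$ together with the free group $F_k$ of rank $k=(n,A)-(n,A,f)$: \[G\cong\left(\ast_{i=1}^{(n,A,f)}\bar{G}\right)\ast F_k.\] In particular, if $(n,A)(n,f)=n(n,A,f)$, then \[G\cong\left(\ast_{i=1}^{(n,A,f)}\mathbb{Z}_{(n,f)\mu/n}\right)\ast F_k\] is a free product of cyclic groups.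
   Context: $(a,b,\dots)$ denotes the greatest common divisor, with $(n,0)=n$; $\mathbb{Z}_k$ is the cyclic group of order $k$. For a word $w$ in $x_0,\dots,x_{n-1}$, $G_n(w)=\langle x_0,\dots,x_{n-1}\mid w,\theta(w),\dots,\theta^{n-1}(w)\rangle$ where $\theta(x_i)=x_{i+1}$, subscripts modulo $n$. The cyclically presented group in class $\mathfrak{M}$ determined by $(r,n,s,f,A)$ (with $n>0$, $r\ge 0$, $f(r-s)\equiv 0\bmod n$) is $G=G_n(w)$ where $w=\prod_{i=0}^{r-1}x_{if}\left(\prod_{i=0}^{s-1}x_{A+if}\right)^{-1}$ if $s\geq 0$ and $w=\prod_{i=0}^{r-1}x_{if}\prod_{i=0}^{|s|-1}x_{A+(r+i)f}$ if $s\leq 0$. Equivalently, $G$ is the kernel of the retraction $\nu^f:E\to\langle t\rangle\cong\mathbb{Z}_n$, $\nu^f(t)=t$, $\nu^f(y)=t^f$, where $E=\langle t,y\mid t^n,\ y^rt^Ay^{-s}t^{-A}\rangle$. For integers $M,N,R,\lambda$ with $R^N\equiv 1\bmod M$, $B(M,N,R,\lambda)=\langle a,b\mid a^M=1,\ bab^{-1}=a^R,\ b^N=a^{\lambda M/(M,R-1)}\rangle$. The parameter $R$ matters only modulo $M$; since $s\hat r$ is a unit modulo $\mu$, its powers with possibly negative exponents are read modulo $\mu$. *)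

(* Defs.v *)
From HB Require Import structures.
From mathcomp Require Import all_boot all_order all_algebra.
From mathcomp Require Import boolp.

Set Implicit Arguments.
Unset Strict Implicit.
Unset Printing Implicit Defensive.

Import GRing.Theory.

(* The letter (x, false) stands for the generator x and (x, true) for its
   formal inverse. *)
Definition word (X : Type) : Type := seq (X * bool).

Definition inv_word X (w : word X) : word X :=
  rev [seq (l.1, ~~ l.2) | l <- w].

Definition expz_word X (w : word X) (m : int) : word X :=
  match m with
  | Posz k => flatten (nseq k w)
  | Negz k => flatten (nseq k.+1 (inv_word w))
  end.

(* Two words are related iff they represent the same element of the group
   < X | rels >: this is the congruence generated by free cancellation and by
   deletion of relators. *)
Inductive pres_eq (X : Type) (rels : word X -> Prop) : word X -> word X -> Prop :=
  | pres_refl w : pres_eq rels w w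
  | pres_sym v w : pres_eq rels v w -> pres_eq rels w v
  | pres_trans u v w : pres_eq rels u v -> pres_eq rels v w -> pres_eq rels u w
  | pres_cancel u v x e :
      pres_eq rels (u ++ [:: (x, e); (x, ~~ e)] ++ v) (u ++ v)
  | pres_rel u v w : rels w -> pres_eq rels (u ++ w ++ v) (u ++ v).

Section Presentation.
Variables (X : choiceType) (rels : word X -> Prop).

Definition pres_eqb : rel (seq (X * bool)) := fun v w => `[< pres_eq rels v w >].

Lemma pres_eqb_refl : reflexive pres_eqb.
Proof. by move=> w; apply/asboolP; apply: pres_refl. Qed.

Lemma pres_eqb_sym : symmetric pres_eqb.
Proof. by move=> v w; apply/asboolP/asboolP; apply: pres_sym. Qed.

Lemma pres_eqb_trans : transitive pres_eqb.
Proof. by move=> v u w /asboolP uv /asboolP vw; apply/asboolP/(pres_trans uv). Qed.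

Canonical pres_equiv := EquivRel pres_eqb pres_eqb_refl pres_eqb_sym pres_eqb_trans.

Definition pres_group : Type := {eq_quot pres_equiv}%qT.
HB.instance Definition _ := Choice.on pres_group.
HB.instance Definition _ := Quotient.on pres_group.

Local Notation pg_repr := (@repr _ pres_group).
Local Notation pg_pi := (@generic_quotient.pi _ pres_group).

Lemma pg_piP v w : (pg_pi v = pg_pi w) <-> pres_eq rels v w.
Proof. by split=> [/eqquotP /asboolP //|vw]; apply/eqquotP/asboolP. Qed.

Lemma pg_reprP w : pres_eq rels (pg_repr (pg_pi w)) w.
Proof. by apply/pg_piP; rewrite reprK. Qed.

Lemma pres_eq_catl u v w : pres_eq rels v w -> pres_eq rels (u ++ v) (u ++ w).
Proof.
elim=> {v w} [w|v w _|v1 v2 v3 _ v12 _ v23|v w x e|v w s s_rel].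
- exact: pres_refl.
- exact: pres_sym.
- exact: pres_trans v12 v23.
- by rewrite !(catA u); apply: pres_cancel.
- by rewrite !(catA u); apply: pres_rel.
Qed.

Lemma pres_eq_catr u v w : pres_eq rels v w -> pres_eq rels (v ++ u) (w ++ u).
Proof.
elim=> {v w} [w|v w _|v1 v2 v3 _ v12 _ v23|v w x e|v w s s_rel].
- exact: pres_refl.
- exact: pres_sym.
- exact: pres_trans v12 v23.
- by rewrite -!catA; apply: pres_cancel.
- by rewrite -!catA; apply: pres_rel.
Qed.

Lemma pres_eq_mulV w : pres_eq rels (w ++ inv_word w) [::].
Proof.
elim: w => [|[x e] w IHw]; first exact: pres_refl.
rewrite /inv_word /= rev_cons -cats1 -cat1s catA -catA.
apply: pres_trans (pres_cancel rels [::] [::] x e).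
apply: (@pres_eq_catl [:: (x, e)] _ [:: (x, ~~ e)]).
by rewrite catA -[X in pres_eq _ _ X]cat0s; apply: pres_eq_catr.
Qed.

Lemma inv_wordK (w : word X) : inv_word (inv_word w) = w.
Proof.
rewrite /inv_word map_rev revK -map_comp -[RHS]map_id.
by apply: eq_map => -[x e] /=; rewrite negbK.
Qed.

Lemma pres_eq_mulVl w : pres_eq rels (inv_word w ++ w) [::].
Proof. by rewrite -[X in _ ++ X]inv_wordK; apply: pres_eq_mulV. Qed.

Definition pg_one : pres_group := pg_pi [::].
Definition pg_mul (g h : pres_group) : pres_group := pg_pi (pg_repr g ++ pg_repr h).
Definition pg_inv (g : pres_group) : pres_group := pg_pi (inv_word (pg_repr g)).

Lemma pg_mulA : associative pg_mul.
Proof.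
move=> g h k; apply/pg_piP.
apply: pres_trans (pres_eq_catl _ (pg_reprP _)) _.
by rewrite catA; apply/pres_eq_catr/pres_sym/pg_reprP.
Qed.

Lemma pg_mul1 : left_id pg_one pg_mul.
Proof.
move=> g; rewrite -[RHS]reprK; apply/pg_piP.
by rewrite -[X in pres_eq _ _ X]cat0s; apply/pres_eq_catr/pg_reprP.
Qed.

Lemma pg_mul1r : right_id pg_one pg_mul.
Proof.
move=> g; rewrite -[RHS]reprK; apply/pg_piP.
by rewrite -[X in pres_eq _ _ X]cats0; apply/pres_eq_catl/pg_reprP.
Qed.

Lemma pg_mulV : left_inverse pg_one pg_inv pg_mul.
Proof.
move=> g; apply/pg_piP.
exact: pres_trans (pres_eq_catr _ (pg_reprP _)) (pres_eq_mulVl _).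
Qed.

Lemma pg_mulVr : right_inverse pg_one pg_inv pg_mul.
Proof.
move=> g; apply/pg_piP.
exact: pres_trans (pres_eq_catl _ (pg_reprP _)) (pres_eq_mulV _).
Qed.

HB.instance Definition _ :=
  isGroup.Build pres_group pg_mulA pg_mul1 pg_mul1r pg_mulV pg_mulVr.

End Presentation.

Definition group_iso (G H : groupType) : Prop :=
  exists phi : {multiplicative G -> H}, bijective phi.

Definition free_group (k : nat) : groupType :=
  pres_group (fun _ : word 'I_k => False).

(* The free product of the H i, presented by their disjoint union subject to
   their multiplication tables. *)
Inductive free_prod_rel (I : choiceType) (H : I -> groupType) :
    word {i : I & H i} -> Prop :=
  | FreeProdRel i (x y : H i) :
      free_prod_rel [:: (existT _ i x, false); (existT _ i y, false);
                        (existT _ i (x * y)%g, true)].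

Definition free_prod (I : choiceType) (H : I -> groupType) : groupType :=
  pres_group (@free_prod_rel I H).

Definition free_prod2 (G H : groupType) : groupType :=
  free_prod (fun b : bool => if b then G else H).

(* For k > 0, 'I_k.-1.+1 is 'I_k with addition modulo k (unlike 'Z_k, this is
   the right group for k = 1 too). *)
Definition cyclic_group (k : nat) : groupType := 'I_k.-1.+1.

Local Open Scope ring_scope.

Section CyclicallyPresented.
Variables (n : nat).

Definition theta (w : word 'I_n) : word 'I_n := [seq (ordS l.1, l.2) | l <- w].

Definition cyc_pres_group (w : word 'I_n) : groupType :=
  pres_group (fun v => exists2 j, (j < n)%N & v = iter j theta w).

Hypothesis n_gt0 : (0 < n)%N.

Lemma absz_modz_lt (i : int) : (`|(i %% n%:Z)%Z| < n)%N.
Proof.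
have nP : 0 < n%:Z by rewrite ltz_nat.
by rewrite -ltz_nat gez0_abs ?ltz_pmod ?modz_ge0 // Order.POrderTheory.gt_eqF.
Qed.

Definition idx (i : int) : 'I_n := Ordinal (absz_modz_lt i).

(* x_c x_(c+f) ... x_(c+(m-1)f) *)
Definition progression (c f : int) (m : nat) : word 'I_n :=
  [seq (idx (c + i%:Z * f), false) | i <- iota 0 m].

Definition classM_word (r : nat) (s f A : int) : word 'I_n :=
  if 0 <= s then progression 0 f r ++ inv_word (progression A f `|s|%N)
  else progression 0 f r ++ progression (A + r%:Z * f) f `|s|%N.

Definition classM_group (r : nat) (s f A : int) : groupType :=
  cyc_pres_group (classM_word r s f A).

End CyclicallyPresented.

(* The generators a and b of B(M, N, R, lambda) are true and false; a relation
   u = v is the relator u v^-1. The condition R ^ N = 1 mod M usually attached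
   to these parameters is not needed to form the presentation. *)
Section GroupB.
Variables M N R lambda : int.

Let a (m : int) : word bool := expz_word [:: (true, false)] m.
Let b (m : int) : word bool := expz_word [:: (false, false)] m.

Inductive B_rel : word bool -> Prop :=
  | B_rel_a : B_rel (a M)
  | B_rel_conj : B_rel ((b 1 ++ a 1 ++ b (- 1)) ++ inv_word (a R))
  | B_rel_b : B_rel (b N ++ inv_word (a (lambda * M %/ gcdz M (R - 1))%Z)).

Definition B_group : groupType := pres_group B_rel.
End GroupB.

(* R is congruent modulo mu to u ^ e, where u is a unit modulo mu and e may be
   negative. *)
Definition eq_expz_mod (mu : nat) (u e R : int) : Prop :=
  match e with
  | Posz k => (R = u ^+ k %[mod mu%:Z])%Z
  | Negz k => (R * u ^+ k.+1 = 1 %[mod mu%:Z])%Z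
  end.

(* Main.v *)
From HB Require Import structures.
Require Import Defs.
From mathcomp Require Import all_boot all_order all_algebra.
From mathcomp Require Import zify ring boolp.

(** The idea is Bass-Serre theory for the extension
      E = < t, y | t^n, y^r t^A y^(-s) t^(-A) >
    of G by Z_n. The relator mentions t only through tau = t^(n,A), so E is the
    amalgam of < t > = Z_n and of the vertex group
      H = < y, tau | tau^m, y^r tau^al = tau^al y^s >, m = n/(n,A), al = A/(n,A),
    over < tau > = Z_m. The map E -> Z_n, t -> 1, y -> f, is injective on < t >,
    so its kernel G acts freely on the vertices of type < t > and on the edges
    of the Bass-Serre tree. The quotient graph has one vertex with trivial
    group, D = (n,A,f) vertices whose group is the kernel K of H -> Z_n, and
    (n,A) edges; hence G is the free product of D copies of K and of a free
    group of rank (n,A) - D.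

    [kernel_decomposition] proves this without trees, for every group B
    embedded in H with image K. The covering with vertex set Z_n is made
    explicit: an integer c has coordinates (rowi c, coli c, hgt c), which choose
    the component of c under H and a path [rep c] in H from its base point to
    c, and [gauge c] is trivial when coli c = 0 and a free generator otherwise.
    The map from G sends x_c to the edge y at c, corrected at both ends by
    [rep] and [gauge]; such products telescope ([arrowM]), and the defining
    relations become relations of H. The inverse computes in the semidirect
    product of G by Z_n, which plays the role of E and in which H acts
    ([eta]).

    When r and s are coprime and mu = |r^m - s^m| is not 0, H is a split
    metacyclic group: y has order exactly mu ([vy_mu], [vy_order]) and tau acts
    on it by a power map ([vt_conj]). Then K is generated by the powers of y^p,
    p = n/(n,f), and by b = y^i0 tau^j0, i0 = (n,A)/D, j0 = -f/D ([kernel_ind]).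
    For a suitable unit v modulo mu, a = y^(p v) and b satisfy
    b^N = a^(M/(M,R-1)); this is [metacyclic_exponent], which rests on the
    factorisation
    r^m - s^m = (r^g - s^g) T, T = r^(g(N-1)) + ... + s^(g(N-1)), and on
    T = N r^(g(N-1)) modulo p. The relations of B(M, N, R, 1) then define K
    ([B_emb_inj], [B_emb_image]). If N = 1 then b is itself a power of y^p and
    K is cyclic of order M ([cyclic_emb_image]). *)

Set Implicit Arguments.
Unset Strict Implicit.
Unset Printing Implicit Defensive.

Import GRing.Theory Num.Theory.

Local Open Scope ring_scope.
Local Open Scope group_scope.

(** * Integer powers and homomorphisms *)

Definition expgz (G : groupType) (x : G) (k : int) : G :=
  match k with Posz n => x ^+ n | Negz n => x ^- n.+1 end.

Notation "x ^z k" := (expgz x k) (at level 30, right associativity) : group_scope.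

Section IntPower.
Variable G : groupType.
Implicit Types (x y : G) (k l : int).

Lemma expgz0 x : x ^z 0 = 1. Proof. by []. Qed.

Lemma expgz1 x : x ^z 1 = x. Proof. by []. Qed.

Lemma expgzS x k : x ^z (k + 1)%R = x ^z k * x.
Proof.
case: k => [n|[|n]]; first by rewrite -PoszD addn1 /= expgSr.
  by rewrite /= expg1 mulVg.
have -> : (Negz n.+1 + 1)%R = Negz n by lia.
by rewrite /= (expgS _ n.+1) invgM mulgVK.
Qed.

Lemma expgzP x k : x ^z (k - 1)%R = x ^z k * x^-1.
Proof. by rewrite -[k in RHS](subrK 1%R) expgzS mulgK. Qed.

Lemma expgzD x k l : x ^z (k + l)%R = x ^z k * x ^z l.
Proof.
elim/int_ind: l => [|l IHl|l IHl]; first by rewrite addr0 mulg1.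
  by rewrite -addn1 PoszD addrA !expgzS IHl mulgA.
by rewrite -addn1 PoszD opprD addrA !expgzP IHl mulgA.
Qed.

Lemma expgzN x k : x ^z (- k)%R = (x ^z k)^-1.
Proof. by apply: (mulIg (x ^z k)); rewrite mulVg -expgzD addNr. Qed.

Lemma expgzB x k l : x ^z (k - l)%R = x ^z k * (x ^z l)^-1.
Proof. by rewrite expgzD expgzN. Qed.

Lemma expgzM x k l : x ^z (k * l)%R = (x ^z k) ^z l.
Proof.
elim/int_ind: l => [|l IHl|l IHl]; first by rewrite mulr0.
  by rewrite -addn1 PoszD [RHS]expgzS mulrDr mulr1 expgzD IHl.
by rewrite -addn1 PoszD opprD [RHS]expgzP mulrDr mulrN1 expgzD IHl (expgzN x k).
Qed.

Lemma exp1gz k : 1 ^z k = 1 :> G.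
Proof. by case: k => n /=; rewrite expg1n ?invg1. Qed.

Lemma expgzC x k l : x ^z k * x ^z l = x ^z l * x ^z k.
Proof. by rewrite -!expgzD addrC. Qed.

Lemma expgz_conj x y k : x * y ^z k * x^-1 = (x * y * x^-1) ^z k.
Proof.
have conjX n : x * y ^+ n * x^-1 = (x * y * x^-1) ^+ n.
  elim: n => [|n IHn]; first by rewrite !expg0 mulg1 mulgV.
  by rewrite !expgSr -IHn !mulgA mulgVK.
by case: k => n //=; rewrite -conjX !invgM invgK mulgA.
Qed.

Lemma expgz_mod x d k l :
  x ^z d = 1 -> (d %| (k - l)%R)%Z -> x ^z k = x ^z l.
Proof.
move=> xd /dvdzP[q kl]; rewrite -[k](subrK l) kl mulrC expgzD expgzM xd.
by rewrite exp1gz mul1g.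
Qed.

End IntPower.

Section Homomorphisms.
Variables (G H : groupType) (f : G -> H).
Hypothesis fM : {morph f : x y / x * y}.

Lemma hom1 : f 1 = 1.
Proof. by apply: (mulgI (f 1)); rewrite -fM !mulg1. Qed.

Lemma homV : {morph f : x / x^-1}.
Proof. by move=> x; apply: (mulgI (f x)); rewrite -fM !mulgV hom1. Qed.

Lemma homX k : {morph f : x / x ^+ k}.
Proof. by elim: k => [|k IHk] x; rewrite ?hom1 // !expgS fM IHk. Qed.

Lemma homXz k : {morph f : x / x ^z k}.
Proof. by case: k => k x /=; rewrite ?homV homX. Qed.

Lemma hom_inj : (forall x, f x = 1 -> x = 1) -> injective f.
Proof.
by move=> f1 x y fxy; apply/divg1_eq/f1; rewrite fM homV fxy mulgV.
Qed.

End Homomorphisms.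

Lemma group_iso_of_inverse_homs (G H : groupType) (f : G -> H) (g : H -> G) :
  {morph f : x y / x * y} -> cancel f g -> cancel g f -> group_iso G H.
Proof.
move=> fM fK gK.
pose fhom := HB.pack_for {multiplicative G -> H} f
  (@isMultiplicative.Build G H f fM).
by exists fhom; exists g.
Qed.

(** * Groups given by presentations *)

Section Words.
Variables (X : Type) (K : groupType) (phi : X -> K).

Definition weval (w : word X) : K :=
  \prod_(l <- w) (if l.2 then (phi l.1)^-1 else phi l.1).

Lemma weval_nil : weval [::] = 1. Proof. exact: big_nil. Qed.

Lemma weval_cons l w :
  weval (l :: w) = (if l.2 then (phi l.1)^-1 else phi l.1) * weval w.
Proof. exact: big_cons. Qed.

Lemma weval_cat v w : weval (v ++ w) = weval v * weval w.
Proof. exact: big_cat. Qed.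

Lemma weval_inv w : weval (inv_word w) = (weval w)^-1.
Proof.
elim: w => [|[x e] w IHw]; first by rewrite /inv_word /= weval_nil invg1.
rewrite /inv_word /= rev_cons -cats1 weval_cat [weval (rev _)]IHw.
by rewrite !weval_cons weval_nil /= mulg1 invgM; case: e; rewrite ?invgK.
Qed.

Lemma weval_expz w k : weval (expz_word w k) = weval w ^z k.
Proof.
have flat n v : weval (flatten (nseq n v)) = weval v ^+ n.
  elim: n => [|n IHn]; first exact: weval_nil.
  by rewrite /= weval_cat IHn expgS.
by case: k => n; rewrite /expz_word flat // weval_inv expVgn.
Qed.

End Words.

Section Presentations.
Variables (X : choiceType) (rels : word X -> Prop).
Local Notation P := (pres_group rels).

Definition pgen (x : X) : P := @generic_quotient.pi _ P [:: (x, false)].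

Lemma pi_cat v w : @generic_quotient.pi _ P (v ++ w) =
  @generic_quotient.pi _ P v * @generic_quotient.pi _ P w.
Proof.
apply/pg_piP/pres_sym.
apply: pres_trans (pres_eq_catl _ (pg_reprP _ _)) _.
exact/pres_eq_catr/pg_reprP.
Qed.

Lemma pi_weval w : @generic_quotient.pi _ P w = weval pgen w.
Proof.
elim: w => [|[x e] w IHw]; first by rewrite weval_nil.
rewrite -cat1s pi_cat IHw weval_cons /=; congr (_ * _); case: e => //.
apply: (mulIg (pgen x)); rewrite mulVg -pi_cat; apply/pg_piP.
exact: (pres_cancel rels [::] [::] x true).
Qed.

Lemma pgen_rel w : rels w -> weval pgen w = 1.
Proof.
move=> w_rel; rewrite -pi_weval; apply/pg_piP.
by have := pres_rel [::] [::] w_rel; rewrite cats0.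
Qed.

(** Induction on a word, letter by letter from the left. It serves to show
    that normal forms exhaust a group, when only products with a generator
    can be put in normal form at once. *)
Lemma pres_ind_letter (Q : P -> Prop) :
  Q 1 -> (forall x g, Q g -> Q (pgen x * g)) ->
  (forall x g, Q g -> Q ((pgen x)^-1 * g)) -> forall g, Q g.
Proof.
move=> Q1 Qgen QgenV g; rewrite -[g]generic_quotient.reprK pi_weval.
elim: (generic_quotient.repr g) => [|[x e] w IHw]; first by rewrite weval_nil.
by rewrite weval_cons; case: e; [apply: QgenV | apply: Qgen].
Qed.

Lemma pres_ind (Q : P -> Prop) :
  Q 1 -> (forall x, Q (pgen x)) -> (forall g, Q g -> Q g^-1) ->
  (forall g h, Q g -> Q h -> Q (g * h)) -> forall g, Q g.
Proof.
move=> Q1 Qgen QV QM; apply: pres_ind_letter => // x g Qg; apply: QM => //.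
exact: QV.
Qed.

Variable K : groupType.

Lemma pres_hom_ext (f g : P -> K) :
  {morph f : x y / x * y} -> {morph g : x y / x * y} ->
  (forall x, f (pgen x) = g (pgen x)) -> f =1 g.
Proof.
move=> fM gM fg; apply: pres_ind => [|//|h fgh|h k fgh fgk].
- by rewrite !hom1.
- by rewrite !homV // fgh.
- by rewrite fM gM fgh fgk.
Qed.

(** The value is read off a chosen representative, so that the map is a total
    function of [phi]; it is a homomorphism as soon as [phi] kills the
    relators. *)
Definition pres_lift (phi : X -> K) (g : P) : K :=
  weval phi (generic_quotient.repr g).

Variable phi : X -> K.
Hypothesis phi_rels : forall w, rels w -> weval phi w = 1.

Lemma pres_lift_pi w : pres_lift phi (@generic_quotient.pi _ P w) = weval phi w.
Proof.
have: pres_eq rels (generic_quotient.repr (@generic_quotient.pi _ P w)) w.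
  exact: pg_reprP.
rewrite /pres_lift; move: (generic_quotient.repr _) => v0.
elim=> {v0 w} [//|//|u v w _ -> _ -> //|u v x e|u v w /phi_rels w1];
  rewrite !weval_cat.
  rewrite !weval_cons weval_nil /= mulg1.
  by case: e; rewrite /= ?mulVg ?mulgV ?mul1g.
by rewrite w1 mul1g.
Qed.

Lemma pres_lift_hom : {morph pres_lift phi : x y / x * y}.
Proof. by move=> x y; rewrite /= pres_lift_pi weval_cat. Qed.

Lemma pres_lift_gen x : pres_lift phi (pgen x) = phi x.
Proof. by rewrite pres_lift_pi weval_cons weval_nil mulg1. Qed.

End Presentations.

Section FreeProducts.
Variables (I : choiceType) (H : I -> groupType).
Local Notation P := (free_prod H).

Definition fp_in i (x : H i) : P := pgen _ (existT H i x).

Lemma fp_in_hom i : {morph @fp_in i : x y / x * y}.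
Proof.
move=> x y; have := pgen_rel (FreeProdRel x y).
by rewrite !weval_cons weval_nil /= mulg1 mulgA => /divg1_eq.
Qed.

Variables (K : groupType) (phi : forall i, H i -> K).
Hypothesis phiM : forall i, {morph @phi i : x y / x * y}.

Definition fp_lift : P -> K :=
  pres_lift (fun ix : {i : I & H i} => phi (projT2 ix)).

Lemma fp_lift_rels w :
  free_prod_rel w -> weval (fun ix : {i : I & H i} => phi (projT2 ix)) w = 1.
Proof.
by case=> i x y; rewrite !weval_cons weval_nil /= phiM mulg1 mulgA mulgV.
Qed.

Lemma fp_lift_hom : {morph fp_lift : x y / x * y}.
Proof. exact: (pres_lift_hom fp_lift_rels). Qed.

Lemma fp_lift_in i x : fp_lift (@fp_in i x) = phi x.
Proof. exact: (pres_lift_gen fp_lift_rels). Qed.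

Lemma fp_hom_ext (f g : P -> K) :
  {morph f : x y / x * y} -> {morph g : x y / x * y} ->
  (forall i x, f (@fp_in i x) = g (@fp_in i x)) -> f =1 g.
Proof. by move=> fM gM fg; apply: pres_hom_ext => // -[i x]; apply: fg. Qed.

End FreeProducts.

(** * Semidirect products *)

Record group_action (G C : groupType) := GroupAction {
  act :> C -> G -> G;
  act1 : forall g, act 1 g = g;
  actM : forall c d g, act (c * d) g = act c (act d g);
  act_hom : forall c, {morph act c : x y / x * y}
}.

Section SemidirectProduct.
Variables G C : groupType.

Record sdprod (a : group_action G C) := SD { sdl : G; sdr : C }.

Variable a : group_action G C.

Definition pair_of_sdprod (x : sdprod a) := (sdl x, sdr x).
Definition sdprod_of_pair (x : G * C) := SD a x.1 x.2.
Lemma sdprod_of_pairK : cancel pair_of_sdprod sdprod_of_pair.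
Proof. by case. Qed.

HB.instance Definition _ := Equality.copy (sdprod a) (can_type sdprod_of_pairK).
HB.instance Definition _ := Choice.copy (sdprod a) (can_type sdprod_of_pairK).

Definition sd_mul (x y : sdprod a) := SD a (sdl x * a (sdr x) (sdl y)) (sdr x * sdr y).
Definition sd_one := SD a 1 1.
Definition sd_inv (x : sdprod a) := SD a (a (sdr x)^-1 (sdl x)^-1) (sdr x)^-1.

Lemma sd_mulA : associative sd_mul.
Proof.
move=> x y z; by rewrite /sd_mul /= (act_hom a) actM !mulgA.
Qed.

Lemma sd_mul1 : left_id sd_one sd_mul.
Proof. by case=> g c; rewrite /sd_mul /= act1 !mul1g. Qed.

Lemma sd_mul1r : right_id sd_one sd_mul.
Proof. by case=> g c; rewrite /sd_mul /= (hom1 (act_hom a c)) !mulg1. Qed.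

Lemma sd_mulV : left_inverse sd_one sd_inv sd_mul.
Proof.
case=> g c; rewrite /sd_mul /= -(act_hom a) !mulVg.
by rewrite (hom1 (act_hom a _)).
Qed.

Lemma sd_mulVr : right_inverse sd_one sd_inv sd_mul.
Proof.
case=> g c; rewrite /sd_mul /=; by rewrite -actM mulgV act1 mulgV.
Qed.

HB.instance Definition _ :=
  isGroup.Build (sdprod a) sd_mulA sd_mul1 sd_mul1r sd_mulV sd_mulVr.

Lemma sd_mulE (x y : sdprod a) :
  x * y = SD a (sdl x * a (sdr x) (sdl y)) (sdr x * sdr y).
Proof. by []. Qed.

Lemma sdl_incl_hom : {morph (SD a)^~ 1 : g h / g * h}.
Proof. by move=> g h; rewrite sd_mulE /= act1 mulg1. Qed.

Lemma sdr_incl_hom : {morph SD a 1 : c d / c * d}.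
Proof. by move=> c d; rewrite sd_mulE /= (hom1 (act_hom a c)) mulg1. Qed.

Lemma sdr_hom : {morph @sdr a : x y / x * y}.
Proof. by []. Qed.

Lemma sd_conj c g : SD a 1 c * SD a g 1 * (SD a 1 c)^-1 = SD a (a c g) 1.
Proof.
apply: (mulIg (SD a 1 c)); rewrite mulgVK !sd_mulE /=.
by rewrite act1 !mulg1 !mul1g.
Qed.

End SemidirectProduct.

(** * Residues *)

Lemma cyclic_mulE n (c d : cyclic_group n) :
  (0 < n)%N -> nat_of_ord (c * d : cyclic_group n) = ((c + d) %% n)%N.
Proof. by case: n c d. Qed.

Section Residues.
Variable n : nat.
Hypothesis n_gt0 : (0 < n)%N.

(** The group Z_n has carrier 'I_n.-1.+1, hence [inord]; it is kept apart from
    the index type 'I_n of the generators, which [idx] covers. *)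
Definition cres (k : int) : cyclic_group n := inord `|(k %% n%:Z)%Z|.

Lemma cresE k : (cres k : nat) = `|(k %% n%:Z)%Z|%N.
Proof. by rewrite inordK // prednK ?absz_modz_lt. Qed.

Lemma idxE k : (idx n_gt0 k)%:Z = (k %% n%:Z)%Z.
Proof. by rewrite /= gez0_abs // modz_ge0; lia. Qed.

Lemma cresEz k : (cres k)%:Z = (k %% n%:Z)%Z.
Proof. by rewrite cresE gez0_abs // modz_ge0; lia. Qed.

Lemma eq_cres k l : (cres k = cres l) <-> (n%:Z %| (k - l)%R)%Z.
Proof.
rewrite -eqz_mod_dvd; split=> [kl | /eqP kl].
  by rewrite -!cresEz kl.
by apply: val_inj; rewrite /= !cresE kl.
Qed.

Lemma cresD k l : cres (k + l)%R = cres k * cres l.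
Proof.
apply/ord_inj/eqP; rewrite -eqz_nat cresEz cyclic_mulE // -modz_nat PoszD.
by rewrite !cresEz modzDm.
Qed.

Lemma cres0 : cres 0 = 1.
Proof. by apply: (mulgI (cres 0)); rewrite -cresD mulg1. Qed.

Lemma cres_eq1 k : (cres k = 1) <-> (n%:Z %| k)%Z.
Proof. by rewrite -cres0 eq_cres subr0. Qed.

Lemma cresN k : cres (- k)%R = (cres k)^-1.
Proof. by apply: (mulIg (cres k)); rewrite mulVg -cresD addNr cres0. Qed.

Lemma cresX k q : cres k ^+ q = cres (k * q%:Z)%R.
Proof.
elim: q => [|q IHq]; first by rewrite mulr0 cres0.
by rewrite expgSr IHq -cresD; congr cres; lia.
Qed.

Lemma cresXz k l : cres k ^z l = cres (k * l)%R.
Proof.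
by case: l => q; rewrite /= cresX // NegzE mulrN cresN.
Qed.

Lemma cres_surj (c : cyclic_group n) : c = cres (c : nat)%:Z.
Proof.
apply: val_inj; rewrite /= cresE modz_nat absz_nat modn_small //.
by apply: leq_trans (ltn_ord c) _; rewrite (prednK n_gt0).
Qed.

Lemma eq_idx k l : (n%:Z %| (k - l)%R)%Z -> idx n_gt0 k = idx n_gt0 l.
Proof.
rewrite -eqz_mod_dvd => /eqP kl; apply/val_inj/eqP.
by rewrite -eqz_nat !idxE kl.
Qed.

Lemma idx_nat (o : 'I_n) : idx n_gt0 (o : nat)%:Z = o.
Proof. by apply/val_inj; rewrite /= modz_nat absz_nat modn_small. Qed.

Lemma idx_dvd k : (n%:Z %| (k - (idx n_gt0 k : nat)%:Z)%R)%Z.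
Proof. by rewrite -eqz_mod_dvd idxE modz_mod. Qed.

End Residues.

(** * Cyclic presentations *)

(** In the extension of G by Z_n the generator x_c is the edge labelled y that
    leaves the vertex c; a [walk] is the path of q successive edges. *)
Section Paths.
Variables (K : groupType) (xi : int -> K) (f : int).

Definition walk c q : K := \prod_(i <- iota 0 q) xi (c + i%:Z * f)%R.

Lemma walk0 c : walk c 0 = 1. Proof. exact: big_nil. Qed.

Lemma walkS c q : walk c q.+1 = walk c q * xi (c + q%:Z * f)%R.
Proof. by rewrite /walk -addn1 iotaD big_cat big_seq1. Qed.

End Paths.

Lemma eq_walk (K : groupType) (xi zeta : int -> K) f c q :
  xi =1 zeta -> walk xi f c q = walk zeta f c q.
Proof. by move=> eq_xi; apply: eq_bigr => i _; apply: eq_xi. Qed.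

Section ClassM.
Variables (r n : nat) (s f A : int).
Hypothesis n_gt0 : (0 < n)%N.
Local Notation G := (classM_group n_gt0 r s f A).

(** The defining relation read from the vertex c. For s < 0 the letters of the
    second progression stay on the left-hand side, starting at the point
    c + A + rf that the first progression and the jump A have reached. *)
Definition walk_relation (K : groupType) (xi : int -> K) c :=
  if (0 <= s)%R then walk xi f c r = walk xi f (c + A)%R `|s|%N
  else walk xi f c r * walk xi f (c + A + r%:Z * f)%R `|s|%N = 1.

Lemma weval_progression (K : groupType) (phi : 'I_n -> K) c q :
  weval phi (progression n_gt0 c f q) = walk (phi \o idx n_gt0) f c q.
Proof. by rewrite /weval /progression big_map. Qed.

Lemma iter_theta_progression j c q :
  iter j (@theta n) (progression n_gt0 c f q)
  = progression n_gt0 (c + j%:Z)%R f q.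
Proof.
elim: j c => [|j IHj] c; first by rewrite addr0.
rewrite iterSr /theta /progression -map_comp -/(progression n_gt0 _ f q).
rewrite (eq_map (g := fun i : nat =>
  (idx n_gt0 (c + 1 + i%:Z * f)%R, false))) => [|i /=].
  by rewrite -[map _ _]/(progression n_gt0 (c + 1)%R f q) IHj; congr progression; lia.
congr (_, _); apply/val_inj/eqP; rewrite -eqz_nat idxE /= -modz_nat.
rewrite -addn1 PoszD gez0_abs ?modz_ge0 ?modzDml //; try lia.
by apply/eqP; congr modz; lia.
Qed.

Lemma iter_theta_cat j v w :
  iter j (@theta n) (v ++ w) = iter j (@theta n) v ++ iter j (@theta n) w.
Proof. by elim: j => //= j ->; rewrite /theta map_cat. Qed.

Lemma iter_theta_inv j w :
  iter j (@theta n) (inv_word w) = inv_word (iter j (@theta n) w).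
Proof.
elim: j => //= j ->; rewrite /theta /inv_word map_rev -!map_comp.
by congr rev; apply: eq_map => -[x e].
Qed.

(** Each application of theta translates all subscripts by one, so the j-th
    relator is the same relation read from the vertex j. *)
Lemma classM_relators (K : groupType) (phi : 'I_n -> K) j :
  weval phi (iter j (@theta n) (classM_word n_gt0 r s f A)) = 1 <->
  walk_relation (phi \o idx n_gt0) j%:Z.
Proof.
rewrite /classM_word /walk_relation; case: ifP => _.
  rewrite iter_theta_cat iter_theta_inv weval_cat weval_inv.
  rewrite !iter_theta_progression !weval_progression add0r [(A + _)%R]addrC.
  by split=> [/divg1_eq|->]; rewrite ?mulgV.
rewrite iter_theta_cat weval_cat !iter_theta_progression !weval_progression.
by rewrite add0r (_ : j%:Z + A + _ = A + r%:Z * f + j%:Z)%R //; lia.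
Qed.

Definition xgen (c : int) : G := pgen _ (idx n_gt0 c).

(** The relators are indexed by 0 <= c < n, but everything is periodic. *)
Lemma walk_xgen_relation c : walk_relation xgen c.
Proof.
have: walk_relation xgen (idx n_gt0 c : nat)%:Z.
  by apply/classM_relators/pgen_rel; exists (idx n_gt0 c : nat).
have per k l q : (n%:Z %| (k - l)%R)%Z -> walk xgen f k q = walk xgen f l q.
  move=> kl; apply: eq_bigr => i _; congr pgen; apply: eq_idx.
  by rewrite (_ : _ - _ = k - l)%R //; lia.
have := idx_dvd n_gt0 c; move: (idx _ _ : nat)%:Z => c' cc'.
rewrite /walk_relation (per c c') // (per (c + A)%R (c' + A)%R).
  rewrite (per (c + A + r%:Z * f)%R (c' + A + r%:Z * f)%R) //.
  by rewrite (_ : _ - _ = c - c')%R //; lia.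
by rewrite (_ : _ - _ = c - c')%R //; lia.
Qed.

End ClassM.

(** * The vertex group *)

(** The subgroup < y, tau > of E, with tau = t^(n,A): the generator true is y
    and false is tau. *)

Section VertexGroup.
Variables (r m : nat) (s al : int).

Inductive vertex_rel : word bool -> Prop :=
  | VertexTau : vertex_rel (expz_word [:: (false, false)] m%:Z)
  | VertexConj : vertex_rel
      ((expz_word [:: (true, false)] r%:Z ++ expz_word [:: (false, false)] al) ++
       inv_word (expz_word [:: (false, false)] al ++ expz_word [:: (true, false)] s)).

Definition vertex_group : groupType := pres_group vertex_rel.

Definition vy : vertex_group := pgen _ true.
Definition vt : vertex_group := pgen _ false.

Section Lift.
Variables (K : groupType) (phi : bool -> K).
Hypothesis phi_tau : phi false ^z m%:Z = 1.
Hypothesis phi_conj :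
  phi true ^z r%:Z * phi false ^z al = phi false ^z al * phi true ^z s.

Lemma vertex_lift_rels w : vertex_rel w -> weval phi w = 1.
Proof.
have eval1 b : weval phi [:: (b, false)] = phi b.
  by rewrite weval_cons weval_nil mulg1.
case; first by rewrite weval_expz eval1.
by rewrite !(weval_cat, weval_inv, weval_expz) !eval1 phi_conj mulgV.
Qed.

End Lift.

Lemma vt_m : vt ^z m%:Z = 1.
Proof.
have := pgen_rel VertexTau.
by rewrite weval_expz weval_cons weval_nil mulg1.
Qed.

Lemma vy_conj : vy ^z r%:Z * vt ^z al = vt ^z al * vy ^z s.
Proof.
have := pgen_rel VertexConj.
rewrite !(weval_cat, weval_inv, weval_expz) !weval_cons !weval_nil !mulg1.
exact: divg1_eq.
Qed.

End VertexGroup.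

Arguments vy {r m s al}.
Arguments vt {r m s al}.

(** * Decomposition along the kernel of the degree map *)

(** Here D = (n,A,f), i0 = (n,A)/D and m = n/(n,A), while f1 = f/D,
    al = A/(n,A), and kap inverts f1 modulo i0. *)

Section Decomposition.
Variables (r n : nat) (s f A : int) (n_gt0 : (0 < n)%N).
Variables (D i0 m : nat) (f1 al kap : int).
Hypothesis n_eq : n = (D * i0 * m)%N.
Hypothesis f_eq : f = (D%:Z * f1)%R.
Hypothesis A_eq : A = ((D * i0)%N%:Z * al)%R.
Hypothesis kapP : (i0%:Z %| (kap * f1 - 1)%R)%Z.
Hypothesis f_rs : (n%:Z %| (f * (r%:Z - s))%R)%Z.

Local Notation G := (classM_group n_gt0 r s f A).
Local Notation H := (vertex_group r m s al).
Local Notation gA := (D * i0)%N.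
Local Notation x := (xgen r s f A n_gt0).

Lemma D_gt0 : (0 < D)%N. Proof. by move: n_gt0 n_eq; case: D => //; lia. Qed.
Lemma i0_gt0 : (0 < i0)%N. Proof. by move: n_gt0 n_eq; case: i0 => //; lia. Qed.
Lemma m_gt0 : (0 < m)%N. Proof. by move: n_gt0 n_eq; case: m => //; lia. Qed.

(** The degree of an element of H is the displacement that it causes on the
    vertex set Z_n. *)
Definition deg : H -> cyclic_group n :=
  pres_lift (fun b => cres n (if b then f else gA%:Z)).

Lemma deg_rels w : vertex_rel r m s al w ->
  weval (fun b => cres n (if b then f else gA%:Z)) w = 1.
Proof.
apply: vertex_lift_rels.
  by rewrite cresXz // cres_eq1 // n_eq; apply/dvdzP; exists 1%R; lia.
rewrite !cresXz // -!cresD //; apply/eq_cres => //.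
by rewrite (_ : _ - _ = f * (r%:Z - s))%R //; ring.
Qed.

Lemma deg_hom : {morph deg : g h / g * h}.
Proof. exact: (pres_lift_hom deg_rels). Qed.

Lemma deg_y : deg vy = cres n f.
Proof. exact: (pres_lift_gen deg_rels). Qed.

Lemma deg_t : deg vt = cres n gA%:Z.
Proof. exact: (pres_lift_gen deg_rels). Qed.

(** The vertices in the H-component of c are the integers congruent to c modulo
    D, with base point rowi c. From there coli c steps f lead to an
    integer congruent to c modulo (n,A) = D i0, and hgt c steps (n,A) lead
    to c. The inverse kap of f/D solves this congruence. *)
Definition rowi (c : int) : 'I_D := idx D_gt0 c.
Definition coli (c : int) : nat := `|((c %/ D%:Z)%Z * kap %% i0%:Z)%Z|%N.
Definition hgt (c : int) : int :=
  ((c - (rowi c)%:Z - (coli c)%:Z * f)%R %/ gA%:Z)%Z.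

Lemma rowi_add c q : rowi (c + D%:Z * q)%R = rowi c.
Proof. by apply: eq_idx; apply/dvdzP; exists q; lia. Qed.

Lemma coliE c : (coli c)%:Z = (((c %/ D%:Z)%Z * kap)%R %% i0%:Z)%Z.
Proof. by rewrite /coli gez0_abs // modz_ge0; have := i0_gt0; lia. Qed.

Lemma coli_add c q : coli (c + gA%:Z * q)%R = coli c.
Proof.
apply/eqP; rewrite -eqz_nat !coliE.
have -> : (gA%:Z * q = (i0%:Z * q) * D%:Z)%R by lia.
rewrite addrC divzMDl; last by have := D_gt0; lia.
by rewrite mulrDl -mulrA mulrC modzMDl.
Qed.

Lemma coord c :
  c = ((rowi c)%:Z + (coli c)%:Z * f + gA%:Z * hgt c)%R.
Proof.
suff /divzK: (gA%:Z %| (c - (rowi c)%:Z - (coli c)%:Z * f)%R)%Z.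
  by rewrite -/(hgt c); lia.
have cE := divz_eq c D%:Z.
rewrite /rowi idxE f_eq.
suff /dvdzP[q Hq] : (i0%:Z %| ((c %/ D%:Z)%Z - (coli c)%:Z * f1)%R)%Z.
  apply/dvdzP; exists q; rewrite PoszM [RHS]mulrCA -Hq.
  by rewrite {1}cE; ring.
have /dvdzP[k kE] := kapP.
have /dvdzP[l lE] : (i0%:Z %| ((c %/ D%:Z)%Z * kap - (coli c)%:Z)%R)%Z.
  by rewrite -eqz_mod_dvd coliE modz_mod.
apply/dvdzP; exists (l * f1 - (c %/ D%:Z)%Z * k)%R.
by rewrite mulrBl mulrAC -lE -mulrA -kE; ring.
Qed.

Lemma coord_uniq (j : 'I_D) (i : nat) :
  (i < i0)%N ->
  (rowi (j%:Z + i%:Z * f)%R = j) * (coli (j%:Z + i%:Z * f)%R = i) *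
  (hgt (j%:Z + i%:Z * f)%R = 0%R).
Proof.
move=> i_lt.
have fE : (i%:Z * f = D%:Z * (i%:Z * f1))%R by rewrite f_eq; ring.
have rowE : rowi (j%:Z + i%:Z * f)%R = j.
  by rewrite fE rowi_add /rowi idx_nat.
have colE : coli (j%:Z + i%:Z * f)%R = i.
  apply/eqP; rewrite -eqz_nat coliE fE addrC [(D%:Z * _)%R]mulrC divzMDl; last first.
    by have := D_gt0; lia.
  rewrite divz_nat (divn_small (ltn_ord j)) addr0.
  rewrite -[X in _ == X](modz_small (d := i0%:Z)); last by lia.
  rewrite eqz_mod_dvd; have /dvdzP[k kE] := kapP.
  by apply/dvdzP; exists (i%:Z * k)%R; rewrite -[RHS]mulrA -kE; ring.
split; first by split.
by rewrite /hgt rowE colE (_ : _ - _ = 0)%R ?div0z //; ring.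
Qed.

Lemma coli_lt c : (coli c < i0)%N.
Proof. by rewrite -ltz_nat coliE ltz_pmod // ltz_nat i0_gt0. Qed.

Lemma hgt_add c q : hgt (c + gA%:Z * q)%R = (hgt c + q)%R.
Proof.
have := coord (c + gA%:Z * q)%R; have := coord c.
rewrite coli_add PoszM -[(_ * _ * q)%R]mulrA rowi_add => cE cE'.
have gA0 : gA%:Z != 0%R by have := D_gt0; have := i0_gt0; lia.
apply: (mulfI gA0).
by move: cE cE'; rewrite PoszM; nia.
Qed.

(** The corresponding path in H. Using the integer hgt c makes rep
    equivariant under steps of tau ([rep_add]); that is why the edges t can be
    made trivial. *)
Definition rep (c : int) : H := vy ^z (coli c)%:Z * vt ^z hgt c.

Lemma rep_add c q : rep (c + gA%:Z * q)%R = rep c * vt ^z q.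
Proof. by rewrite /rep coli_add hgt_add expgzD mulgA. Qed.

Lemma deg_rep c : deg (rep c) = cres n (c - (rowi c)%:Z)%R.
Proof.
rewrite /rep deg_hom !(homXz deg_hom) deg_y deg_t !cresXz // -cresD //.
by congr cres; rewrite {3}(coord c); ring.
Qed.

Variables (B : groupType) (emb : B -> H).
Hypothesis emb_hom : {morph emb : b c / b * c}.
Hypothesis emb_inj : injective emb.
Hypothesis deg_emb : forall b, deg (emb b) = 1.
Variable psi : H -> B.
Hypothesis psiK : forall h, deg h = 1 -> emb (psi h) = h.

Lemma psi_mul g h : deg g = 1 -> deg h = 1 -> psi (g * h) = psi g * psi h.
Proof.
move=> g1 h1; apply: emb_inj; rewrite emb_hom !psiK //.
by rewrite deg_hom g1 h1 mulg1.
Qed.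

Lemma psi1 : psi 1 = 1.
Proof.
by apply: emb_inj; rewrite psiK ?(hom1 deg_hom) // (hom1 emb_hom).
Qed.

Lemma psi_emb b : psi (emb b) = b.
Proof. by apply: emb_inj; rewrite psiK. Qed.

Local Notation k := (gA - D)%N.
Local Notation copies := (free_prod (fun _ : 'I_D => B)).
Local Notation P := (free_prod2 copies (free_group k)).

Definition inB (j : 'I_D) (b : B) : P :=
  @fp_in bool (fun b : bool => if b then copies else free_group k) true
    (@fp_in _ (fun _ : 'I_D => B) j b).
Definition inF (g : free_group k) : P :=
  @fp_in bool (fun b : bool => if b then copies else free_group k) false g.

Lemma inB_hom j : {morph inB j : b c / b * c}.
Proof. by move=> b c; rewrite /inB fp_in_hom fp_in_hom. Qed.

Lemma inF_hom : {morph inF : b c / b * c}.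
Proof. by move=> b c; rewrite /inF fp_in_hom. Qed.

(** Totalised by 1, so that [gauge] is defined without bounds on its
    index. *)
Definition fgen (q : nat) : free_group k :=
  if insub q is Some o then pgen _ (o : 'I_k) else 1.

(** One free generator for each edge of the quotient graph outside a maximal
    tree: the (n,A) edges are the pairs (row, column), and those of column 0
    form the tree. *)
Definition gauge (c : int) : P :=
  if coli c == 0%N then 1 else inF (fgen ((coli c).-1 * D + rowi c)%N).

Lemma gauge_add c q : gauge (c + gA%:Z * q)%R = gauge c.
Proof.
by rewrite /gauge coli_add PoszM -[(_ * _ * q)%R]mulrA rowi_add.
Qed.

(** The functor to the free product from the groupoid of H acting on Z_n: the
    path h from c to c + d is closed up into a loop at the base point, and then
    transported by the gauge. It is functorial by [arrowM], and trivial on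
    tau by [arrow_t]. *)
Definition arrow (c : int) (h : H) (d : int) : P :=
  gauge c * inB (rowi c) (psi (rep c * h * (rep (c + d)%R)^-1)) *
  (gauge (c + d)%R)^-1.

(** The divisibility ensures that h does not leave the component of c, so that
    c and c + d have the same base point. *)
Definition graded (h : H) (d : int) :=
  deg h = cres n d /\ (D%:Z %| d)%Z.

Lemma gradedM g h d e : graded g d -> graded h e -> graded (g * h) (d + e)%R.
Proof.
move=> [gd Dd] [he De]; split; last exact: rpredD.
by rewrite deg_hom gd he -cresD.
Qed.

Lemma gradedV g d : graded g d -> graded g^-1 (- d)%R.
Proof.
by move=> [gd Dd]; split; [rewrite (homV deg_hom) gd cresN | rewrite rpredN].
Qed.

Lemma graded1 : graded 1 0.
Proof. by split; [rewrite (hom1 deg_hom) cres0 | rewrite dvdz0]. Qed.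

Lemma gradedXz g d q : graded g d -> graded (g ^z q) (d * q)%R.
Proof.
move=> [gd Dd]; split; last exact: dvdz_mulr.
by rewrite (homXz deg_hom) gd cresXz.
Qed.

Lemma graded_y : graded vy f.
Proof. by split; [exact: deg_y | rewrite f_eq dvdz_mulr]. Qed.

Lemma graded_t : graded vt gA%:Z.
Proof. by split; [exact: deg_t | rewrite PoszM dvdz_mulr]. Qed.

Lemma rowi_graded c h d : graded h d -> rowi (c + d)%R = rowi c.
Proof. by case=> _ /dvdzP[q ->]; rewrite mulrC rowi_add. Qed.

Lemma deg_loop c h d : graded h d -> deg (rep c * h * (rep (c + d)%R)^-1) = 1.
Proof.
move=> hd; rewrite (deg_hom _ (rep _)^-1) (deg_hom (rep c)) (homV deg_hom).
rewrite !deg_rep (rowi_graded _ hd).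
rewrite hd.1 -cresN // -!cresD //; apply/cres_eq1 => //.
by rewrite (_ : _ + _ = 0)%R //; ring.
Qed.

Lemma arrowM c g d h e : graded g d -> graded h e ->
  arrow c (g * h) (d + e)%R = arrow c g d * arrow (c + d)%R h e.
Proof.
move=> gd he; rewrite /arrow addrA.
have -> : rep c * (g * h) * (rep (c + d + e)%R)^-1 =
    (rep c * g * (rep (c + d)%R)^-1) *
    (rep (c + d)%R * h * (rep (c + d + e)%R)^-1).
  by move: (rep c) (rep (c + d)%R) => u v; rewrite !mulgA mulgVK.
rewrite psi_mul ?deg_loop // inB_hom (rowi_graded c gd).
by rewrite !mulgA mulgVK.
Qed.

Lemma arrow1 c : arrow c 1 0 = 1.
Proof.
by rewrite /arrow mulg1 addr0 mulgV psi1 (hom1 (@inB_hom _)) mulg1 mulgV.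
Qed.

Lemma arrow_t c q : arrow c (vt ^z q) (gA%:Z * q)%R = 1.
Proof.
rewrite /arrow rep_add gauge_add mulgV psi1 (hom1 (@inB_hom _)).
by rewrite mulg1 mulgV.
Qed.

Lemma rep_per c q : rep (c + n%:Z * q)%R = rep c.
Proof.
rewrite n_eq (PoszM _ m) -[(_ * _ * q)%R]mulrA rep_add.
by rewrite expgzM vt_m exp1gz mulg1.
Qed.

Lemma gauge_per c q : gauge (c + n%:Z * q)%R = gauge c.
Proof. by rewrite n_eq (PoszM _ m) -[(_ * _ * q)%R]mulrA gauge_add. Qed.

Lemma rowi_per c q : rowi (c + n%:Z * q)%R = rowi c.
Proof. by rewrite n_eq !PoszM -!mulrA rowi_add. Qed.

Lemma arrow_eq c h d e : (n%:Z %| (d - e)%R)%Z -> arrow c h d = arrow c h e.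
Proof.
move=> /dvdzP[q de]; rewrite -[d](subrK e) de addrC mulrC /arrow addrA.
by rewrite rep_per gauge_per.
Qed.

Lemma arrow_per c h d q : arrow (c + n%:Z * q)%R h d = arrow c h d.
Proof.
by rewrite /arrow addrAC !rep_per !gauge_per rowi_per.
Qed.

Lemma arrowV c h d : graded h d ->
  arrow (c + d)%R h^-1 (- d)%R = (arrow c h d)^-1.
Proof.
move=> hd; apply: (mulgI (arrow c h d)).
by rewrite -arrowM ?mulgV ?subrr ?arrow1 //; exact: gradedV.
Qed.

Definition xarrow (c : int) : P := arrow c vy f.

Lemma walk_xarrow c q :
  walk xarrow f c q = arrow c (vy ^z q%:Z) (f * q%:Z)%R.
Proof.
elim: q => [|q IHq]; first by rewrite walk0 mulr0 arrow1.
rewrite walkS IHq -addn1 PoszD expgzS mulrDr mulr1 arrowM; last first.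
- exact: graded_y.
- exact: gradedXz graded_y.
by rewrite [(q%:Z * f)%R]mulrC.
Qed.

(** The relator is a product of arrows along y^r, tau^al, y^(-s) and
    tau^(-al); inserting the trivial arrows of tau turns it into the arrow of
    a relator of H. *)
Lemma xarrow_relation c : walk_relation r s f A xarrow c.
Proof.
have gy q := gradedXz q graded_y; have gt q := gradedXz q graded_t.
rewrite /walk_relation !walk_xarrow; case: ifP => [s_ge0 | s_lt0].
  have sE : s = `|s|%N%:Z by lia.
  have -> : arrow c (vy ^z r%:Z) (f * r%:Z)%R =
      arrow c (vt ^z al * vy ^z s * (vt ^z al)^-1) (A + f * s - A)%R.
    rewrite -vy_conj mulgK; apply: arrow_eq.
    by rewrite (_ : _ - _ = f * (r%:Z - s))%R //; ring.
  rewrite A_eq arrowM ?arrowM //; last 2 first.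
  - exact: gradedM.
  - exact: gradedV.
  rewrite -expgzN -mulrN !arrow_t mul1g mulg1.
  by congr (arrow _ (vy ^z _) (f * _)%R); rewrite -sE.
have ys : vy ^z s * vy ^z `|s|%N%:Z = 1 :> H.
  by rewrite -expgzD (_ : s + _ = 0)%R //; lia.
rewrite -[arrow c _ _]mulg1 -[X in _ * X * _](arrow_t (c + f * r%:Z)%R al) -A_eq.
rewrite -arrowM ?A_eq //.
have -> : (c + gA%:Z * al + r%:Z * f = c + (f * r%:Z + gA%:Z * al))%R by ring.
rewrite -arrowM //; last exact: gradedM.
set e := (_ + _ + _)%R; set h := _ * _ * _.
have he : graded h e by apply: gradedM => //; apply: gradedM.
rewrite -[LHS]mulg1 -[X in _ * X](arrow_t (c + e)%R (- al)%R) -arrowM //.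
have -> : h * vt ^z (- al)%R = 1.
  by rewrite /h vy_conj -(mulgA (vt ^z al)) ys mulg1 expgzN mulgV.
rewrite (@arrow_eq _ _ _ 0%R) ?arrow1 // subr0 /e.
suff -> : (f * r%:Z + gA%:Z * al + f * `|s|%N%:Z + gA%:Z * - al =
  f * (r%:Z - s))%R by [].
have -> : (`|s|%N%:Z = - s)%R by lia.
ring.
Qed.

Definition to_fp : G -> P := pres_lift (fun o : 'I_n => xarrow (o : nat)%:Z).

Lemma xarrow_idx c : xarrow (idx n_gt0 c : nat)%:Z = xarrow c.
Proof.
have /dvdzP[q cE] := idx_dvd n_gt0 c.
by rewrite -[c in RHS](subrK (idx n_gt0 c : nat)%:Z) cE addrC mulrC /xarrow arrow_per.
Qed.

Lemma to_fp_rels w :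
  (exists2 j, (j < n)%N & w = iter j (@theta n) (classM_word n_gt0 r s f A)) ->
  weval (fun o : 'I_n => xarrow (o : nat)%:Z) w = 1.
Proof.
case=> j _ ->; apply/classM_relators.
have := xarrow_relation j%:Z; rewrite /walk_relation.
by rewrite !(eq_walk _ _ _ xarrow_idx).
Qed.

Lemma to_fp_hom : {morph to_fp : g h / g * h}.
Proof. exact: (pres_lift_hom to_fp_rels). Qed.

Lemma to_fp_x c : to_fp (x c) = xarrow c.
Proof. by rewrite /to_fp (pres_lift_gen to_fp_rels) xarrow_idx. Qed.


(** The automorphism x_i -> x_(i+c) of G; these make Z_n act, and the semidirect
    product replaces E. *)
Definition shift (c : cyclic_group n) : G -> G :=
  pres_lift (fun o : 'I_n => x ((o : nat)%:Z + (c : nat)%:Z)%R).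

Lemma xgen_eq c d : (n%:Z %| (c - d)%R)%Z -> x c = x d.
Proof. by move=> cd; rewrite /xgen (eq_idx _ cd). Qed.

Lemma shift_rels c w :
  (exists2 j, (j < n)%N & w = iter j (@theta n) (classM_word n_gt0 r s f A)) ->
  weval (fun o : 'I_n => x ((o : nat)%:Z + c)%R) w = 1.
Proof.
case=> j _ ->; apply/classM_relators.
have := walk_xgen_relation r s f A n_gt0 (j%:Z + c)%R.
rewrite /walk_relation.
have E d q : walk ((fun o : 'I_n => x (o%:Z + c)%R) \o idx n_gt0) f d q =
    walk x f (d + c)%R q.
  apply: eq_bigr => i _ /=; apply: xgen_eq.
  have /dvdzP[k kE] := idx_dvd n_gt0 (d + i%:Z * f)%R.
  by apply/dvdzP; exists (- k)%R; rewrite mulNr -kE /=; ring.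
rewrite !E !(addrAC _ c) //.
Qed.

Lemma shift_hom c : {morph shift c : g h / g * h}.
Proof. exact: (pres_lift_hom (shift_rels _)). Qed.

Lemma shift_x c d : shift (cres n c) (x d) = x (d + c)%R.
Proof.
rewrite /shift (pres_lift_gen (shift_rels _)); apply: xgen_eq.
have /dvdzP[k kE] := idx_dvd n_gt0 d.
have /dvdzP[l lE] : (n%:Z %| (c - (cres n c : nat)%:Z)%R)%Z.
  by rewrite -eqz_mod_dvd cresEz // modz_mod.
apply/dvdzP; exists (- (k + l))%R; rewrite mulNr mulrDl -kE -lE /=; ring.
Qed.

Lemma G_hom_ext (K : groupType) (g h : G -> K) :
  {morph g : u v / u * v} -> {morph h : u v / u * v} ->
  (forall c, g (x c) = h (x c)) -> g =1 h.
Proof.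
move=> gM hM gh; apply: pres_hom_ext => // o.
by have := gh (o : nat)%:Z; rewrite /xgen idx_nat.
Qed.

Lemma shift1 g : shift 1 g = g.
Proof.
move: g; apply: G_hom_ext => // [|c]; first exact: shift_hom.
by rewrite -(cres0 n_gt0) shift_x addr0.
Qed.

Lemma shiftM c d g : shift (c * d) g = shift c (shift d g).
Proof.
move: g; apply: G_hom_ext => [|u v /=|k]; first exact: shift_hom.
  by rewrite !shift_hom.
rewrite (cres_surj n_gt0 c) (cres_surj n_gt0 d) -cresD // !shift_x.
by congr xgen; ring.
Qed.

Definition shift_action := GroupAction shift1 shiftM shift_hom.
Local Notation E := (sdprod shift_action).

(** The elements t^c and y of E, with y = x_0 t^f. *)
Definition Et (c : int) : E := SD shift_action 1 (cres n c).
Definition Ey : E := SD shift_action (x 0) (cres n f).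
Definition inG (g : G) : E := SD shift_action g 1.

Lemma inG_hom : {morph inG : g h / g * h}.
Proof. exact: sdl_incl_hom. Qed.

Lemma inG_inj : injective inG. Proof. by move=> g h []. Qed.

Lemma inGK (e : E) : sdr e = 1 -> inG (sdl e) = e.
Proof. by case: e => g c /= ->. Qed.

Lemma EtD c d : Et (c + d)%R = Et c * Et d.
Proof. by rewrite /Et cresD // sdr_incl_hom. Qed.

Lemma Et_eq c d : (n%:Z %| (c - d)%R)%Z -> Et c = Et d.
Proof. by move=> /(eq_cres n_gt0) cd; rewrite /Et cd. Qed.

Lemma Et0 : Et 0 = 1. Proof. by rewrite /Et cres0. Qed.

Lemma EtN c : Et (- c)%R = (Et c)^-1.
Proof. by rewrite /Et cresN // (homV (@sdr_incl_hom _ _ _)). Qed.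

Lemma Et_Xz c q : Et c ^z q = Et (c * q)%R.
Proof. by rewrite /Et -cresXz // (homXz (@sdr_incl_hom _ _ _)). Qed.

Lemma inG_x c : inG (x c) = Et c * Ey * (Et (c + f)%R)^-1.
Proof.
rewrite -EtN opprD addrC EtD mulgA -(mulgA (Et c)).
have -> : Ey * Et (- f)%R = inG (x 0).
  by rewrite sd_mulE /= (hom1 (shift_hom _)) mulg1 -cresD // subrr cres0.
by rewrite EtN /Et sd_conj /= shift_x add0r.
Qed.

(** The intermediate powers of t cancel: a walk of q edges is y^q. *)
Lemma inG_walk c q :
  inG (walk x f c q) = Et c * Ey ^z q%:Z * (Et (c + q%:Z * f)%R)^-1.
Proof.
elim: q => [|q IHq].
  by rewrite walk0 mul0r addr0 mulg1 mulgV.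
rewrite walkS inG_hom IHq inG_x -addn1 PoszD expgzS.
rewrite (_ : c + q%:Z * f + f = c + (q%:Z + 1) * f)%R; last by ring.
by rewrite !mulgA mulgVK.
Qed.

(** The defining relation at the vertex 0, where the powers of t at the ends
    of the walks combine because n divides f (r - s). *)
Lemma E_relation : Ey ^z r%:Z * Et A = Et A * Ey ^z s.
Proof.
have := walk_xgen_relation r s f A n_gt0 0.
rewrite /walk_relation add0r; case: ifP => [s_ge0 | s_lt0].
  move=> /(congr1 inG); rewrite !inG_walk Et0 mul1g add0r => eq_walks.
  have sE : (`|s|%N%:Z = s)%R by lia. rewrite sE in eq_walks.
  have -> : Ey ^z r%:Z = Et A * Ey ^z s * (Et (A + s * f)%R)^-1 * Et (r%:Z * f)%R.
    by rewrite -eq_walks mulgVK.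
  rewrite -EtN -!mulgA -!EtD (@Et_eq (_ + _)%R 0%R) ?Et0 ?mulg1 // subr0.
  by rewrite (_ : _ + _ = f * (r%:Z - s))%R //; ring.
move=> /(congr1 inG); rewrite inG_hom !inG_walk Et0 mul1g add0r => eq_walks.
move: eq_walks; rewrite -!EtN !mulgA -(mulgA _ (Et _) (Et _)) -EtD.
rewrite (_ : - (r%:Z * f) + (A + r%:Z * f) = A)%R; last by ring.
rewrite (@Et_eq (- _)%R (- A)%R); last first.
  rewrite (_ : _ - _ = - (f * (r%:Z + `|s|%N%:Z)))%R; last by ring.
  by rewrite rpredN (_ : (r%:Z + `|s|%N%:Z = r%:Z - s)%R) //; lia.
rewrite EtN => /divg1_eq eqA; rewrite -[in RHS]eqA.
by rewrite -!mulgA -expgzD (_ : (_ + s = 0)%R) ?mulg1 //; lia.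
Qed.

Definition eta : H -> E :=
  pres_lift (fun b => if b then Ey else Et gA%:Z).

Lemma eta_rels w : vertex_rel r m s al w ->
  weval (fun b => if b then Ey else Et gA%:Z) w = 1.
Proof.
apply: vertex_lift_rels; last by rewrite Et_Xz -A_eq E_relation.
by rewrite Et_Xz -Et0; apply: Et_eq; rewrite subr0 n_eq -PoszM.
Qed.

Lemma eta_hom : {morph eta : g h / g * h}.
Proof. exact: (pres_lift_hom eta_rels). Qed.

Lemma eta_y : eta vy = Ey. Proof. exact: (pres_lift_gen eta_rels). Qed.
Lemma eta_t : eta vt = Et gA%:Z. Proof. exact: (pres_lift_gen eta_rels). Qed.

Lemma sdr_eta h : sdr (eta h) = deg h.
Proof.
move: h; apply: pres_hom_ext => [g h||[]]; rewrite ?eta_hom //.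
- exact: deg_hom.
- by rewrite [LHS](congr1 (@sdr _ _ _) eta_y) -[pgen _ true]/vy deg_y.
by rewrite [LHS](congr1 (@sdr _ _ _) eta_t) -[pgen _ false]/vt deg_t.
Qed.

(** The element of G carried by the path h from the vertex c to c + d: the
    counterpart of [arrow] in G. *)
Definition unroll (c : int) (h : H) (d : int) : G :=
  sdl (Et c * eta h * (Et (c + d)%R)^-1).

Lemma inG_unroll c h d : graded h d ->
  inG (unroll c h d) = Et c * eta h * (Et (c + d)%R)^-1.
Proof.
move=> [hd _]; apply: inGK; rewrite -EtN !sdr_hom sdr_eta hd /= -!cresD //.
by rewrite (_ : _ + _ = 0)%R ?cres0 //; ring.
Qed.

Lemma unrollM c g d h e : graded g d -> graded h e ->
  unroll c (g * h) (d + e)%R = unroll c g d * unroll (c + d)%R h e.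
Proof.
move=> gd he; apply: inG_inj; rewrite inG_hom !inG_unroll //.
  by rewrite eta_hom addrA !mulgA mulgVK.
exact: gradedM.
Qed.

Lemma unroll1 c : unroll c 1 0 = 1.
Proof.
apply: inG_inj; rewrite inG_unroll ?addr0; last exact: graded1.
by rewrite (hom1 eta_hom) mulg1 mulgV.
Qed.

Lemma unrollV c h d : graded h d ->
  unroll (c + d)%R h^-1 (- d)%R = (unroll c h d)^-1.
Proof.
move=> hd; apply: (mulgI (unroll c h d)).
by rewrite -unrollM ?mulgV ?subrr ?unroll1 //; exact: gradedV.
Qed.

Lemma unroll_y c : unroll c vy f = x c.
Proof.
by apply: inG_inj; rewrite inG_unroll ?inG_x ?eta_y //; exact: graded_y.
Qed.

Lemma unroll_t c q : unroll c (vt ^z q) (gA%:Z * q)%R = 1.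
Proof.
apply: inG_inj; rewrite inG_unroll; last exact: gradedXz graded_t.
by rewrite (homXz eta_hom) eta_t Et_Xz -EtD mulgV.
Qed.

Lemma unroll_eq c h d e : (n%:Z %| (d - e)%R)%Z -> unroll c h d = unroll c h e.
Proof.
move=> de; rewrite /unroll (@Et_eq (c + d)%R (c + e)%R) //.
by rewrite (_ : _ - _ = d - e)%R //; ring.
Qed.

Lemma graded_emb b : graded (emb b) 0.
Proof. by split; rewrite ?dvdz0 // deg_emb cres0. Qed.

Definition of_copy (j : 'I_D) (b : B) : G := unroll j%:Z (emb b) 0.

Lemma of_copy_hom j : {morph of_copy j : b c / b * c}.
Proof.
move=> b c; have := unrollM j%:Z (graded_emb b) (graded_emb c).
by rewrite !addr0 -emb_hom.
Qed.

(** The free generator in row j and column i goes to the inverse of the path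
    y^i from j, read in G; (i - 1) D + j is its index. *)
Definition of_free : free_group k -> G := pres_lift (fun o : 'I_k =>
  (unroll (o %% D)%N%:Z (vy ^z (o %/ D).+1%:Z) (f * (o %/ D).+1%:Z)%R)^-1).

Lemma of_free_hom : {morph of_free : g h / g * h}.
Proof. by apply: pres_lift_hom. Qed.

Definition of_fp : P -> G :=
  @fp_lift bool (fun b : bool => if b then copies else free_group k) G
    (fun b => match b with true => fp_lift of_copy | false => of_free end).

Lemma of_fp_hom : {morph of_fp : g h / g * h}.
Proof.
apply: fp_lift_hom => -[]; [apply: fp_lift_hom | exact: of_free_hom].
exact: of_copy_hom.
Qed.

Lemma of_fp_inB j b : of_fp (inB j b) = of_copy j b.
Proof.
rewrite /of_fp fp_lift_in; first by rewrite (fp_lift_in of_copy_hom).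
by case; [apply: fp_lift_hom; exact: of_copy_hom | exact: of_free_hom].
Qed.

Lemma of_fp_inF g : of_fp (inF g) = of_free g.
Proof.
rewrite /of_fp fp_lift_in //.
by case; [apply: fp_lift_hom; exact: of_copy_hom | exact: of_free_hom].
Qed.

(** The formula also holds in column 0, where both sides are trivial. *)
Lemma of_fp_gauge c : of_fp (gauge c) =
  (unroll (rowi c)%:Z (vy ^z (coli c)%:Z) (f * (coli c)%:Z)%R)^-1.
Proof.
rewrite /gauge; case: eqP => [->|/eqP i_neq0].
  by rewrite mulr0 unroll1 (hom1 of_fp_hom) invg1.
have i_gt0 : (0 < coli c)%N by rewrite lt0n.
have q_lt : ((coli c).-1 * D + rowi c < k)%N.
  have /= lt_row := ltn_ord (rowi c); have := coli_lt c; have := D_gt0.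
  move: i_gt0 lt_row; case: (coli c) => // i _ lt_row _ lt_i /=.
  apply: (@leq_trans (i.+1 * D)%N).
    by rewrite mulSn addnC ltn_add2r.
  by rewrite -[X in (_ <= _ - X)%N]muln1 -mulnBr mulnC leq_mul2l; lia.
rewrite of_fp_inF /fgen insubT /of_free pres_lift_gen //=.
have row_lt : (`|(c %% D%:Z)%Z| < D)%N := ltn_ord (rowi c).
rewrite modnMDl divnMDl ?D_gt0 // (modn_small row_lt) (divn_small row_lt) addn0.
by rewrite (prednK i_gt0).
Qed.

Lemma graded_rep c : graded (rep c) (c - (rowi c)%:Z)%R.
Proof.
split; first exact: deg_rep.
by rewrite -eqz_mod_dvd idxE modz_mod.
Qed.

(** The steps tau of rep c are trivial in G, so only the path y^(coli c)
    remains. *)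
Lemma unroll_rep c : unroll (rowi c)%:Z (rep c) (c - (rowi c)%:Z)%R =
  (of_fp (gauge c))^-1.
Proof.
have -> : (c - (rowi c)%:Z = f * (coli c)%:Z + gA%:Z * hgt c)%R.
  by rewrite {1}(coord c); ring.
rewrite of_fp_gauge invgK.
rewrite unrollM ?unroll_t ?mulg1 //; first exact: gradedXz graded_y.
exact: gradedXz graded_t.
Qed.

(** Splitting the loop at the base point into rep c, h and the inverse of
    rep (c + d), the two outer parts cancel against the gauge. *)
Lemma of_fp_arrow c h d : graded h d -> of_fp (arrow c h d) = unroll c h d.
Proof.
move=> hd; rewrite /arrow !of_fp_hom (homV of_fp_hom) of_fp_inB /of_copy.
rewrite psiK ?deg_loop //.
have gr := graded_rep c; have gr' := gradedV (graded_rep (c + d)%R).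
(* the length 0 of the loop, split along its three parts *)
have -> : 0%R = ((c - (rowi c)%:Z) + d - (c + d - (rowi (c + d)%R)%:Z))%R.
  by rewrite (rowi_graded c hd); ring.
rewrite unrollM ?(unrollM _ gr) //; last exact: gradedM.
rewrite unroll_rep.
rewrite (_ : (rowi c)%:Z + (c - (rowi c)%:Z) = c)%R; last by ring.
rewrite (_ : (rowi c)%:Z + (c - (rowi c)%:Z + d) =
  (rowi (c + d)%R)%:Z + (c + d - (rowi (c + d)%R)%:Z))%R; last first.
  by rewrite (rowi_graded c hd); ring.
rewrite unrollV; last exact: graded_rep.
by rewrite unroll_rep invgK !mulgA mulgV mul1g mulgK.
Qed.

(** Both sides are functorial in h, so it suffices to compare them on y and
    tau. The degree d is only determined modulo n by h, whence the intermediate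
    choice of a degree for which the induction runs. *)
Lemma to_fp_unroll h d c : graded h d -> to_fp (unroll c h d) = arrow c h d.
Proof.
suff [e he arrow_e] : exists2 e, graded h e &
    forall c, to_fp (unroll c h e) = arrow c h e.
  move=> hd; have de : (n%:Z %| (d - e)%R)%Z.
    by apply/eq_cres; rewrite // -hd.1 he.1.
  by rewrite (unroll_eq _ _ de) (arrow_eq _ _ de).
move: h {d c}; apply: pres_ind => [|b|h|g h].
- exists 0%R => [|c]; first exact: graded1.
  by rewrite unroll1 arrow1 (hom1 to_fp_hom).
- case: b; first by exists f => [|c]; [exact: graded_y | rewrite unroll_y to_fp_x].
  exists (gA%:Z * 1)%R => [|c]; first by rewrite mulr1; exact: graded_t.
  by rewrite -[pgen _ false]/(vt ^z 1) unroll_t arrow_t (hom1 to_fp_hom).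
- move=> [d hd IHh]; exists (- d)%R => [|c]; first exact: gradedV.
  by rewrite -[c](subrK d) unrollV // arrowV // (homV to_fp_hom) IHh.
move=> [d gd IHg] [e he IHh]; exists (d + e)%R => [|c]; first exact: gradedM.
by rewrite unrollM // arrowM // to_fp_hom IHg IHh.
Qed.

Lemma to_fpK : cancel to_fp of_fp.
Proof.
apply: (@G_hom_ext _ (of_fp \o to_fp) id) => [g h /=||c //=].
- by rewrite to_fp_hom of_fp_hom.
- by [].
by rewrite to_fp_x of_fp_arrow ?unroll_y //; exact: graded_y.
Qed.

Lemma gauge_row (j : 'I_D) : (gauge j%:Z = 1) * (rep j%:Z = 1) * (rowi j%:Z = j).
Proof.
have := coord_uniq j i0_gt0; rewrite mul0r addr0 => -[[rowE colE] hgtE].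
by rewrite /gauge /rep rowE colE hgtE mulg1.
Qed.

Lemma of_fpK : cancel of_fp to_fp.
Proof.
apply: (@fp_hom_ext _ _ _ (to_fp \o of_fp) id) => [g h /=||b].
- by rewrite of_fp_hom to_fp_hom.
- by [].
case: b => /= g.
  move: g; apply: (@fp_hom_ext _ _ _
    (fun g => to_fp (of_fp (fp_in (i := true) g))) (fun g => fp_in (i := true) g)).
  - by move=> g h; rewrite fp_in_hom of_fp_hom to_fp_hom.
  - by move=> g h; rewrite fp_in_hom.
  move=> j b; rewrite -[fp_in _]/(inB j b) of_fp_inB /of_copy.
  rewrite to_fp_unroll; last exact: graded_emb.
  rewrite /arrow addr0 !gauge_row !mul1g !invg1 !mulg1.
  by rewrite psi_emb.
move: g; apply: (@pres_hom_ext _ _ _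
  (fun g => to_fp (of_fp (inF g))) inF).
- by move=> g h; rewrite inF_hom of_fp_hom to_fp_hom.
- exact: inF_hom.
move=> o; rewrite of_fp_inF /of_free pres_lift_gen // (homV to_fp_hom).
set j := (o %% D)%N; set i := (o %/ D).+1.
rewrite to_fp_unroll; last exact: gradedXz graded_y.
have j_lt : (j < D)%N by rewrite ltn_mod D_gt0.
have i_lt : (i < i0)%N.
  rewrite /i -(ltn_pmul2r D_gt0).
  have := ltn_ord o; have := divn_eq o D.
  have := i0_gt0; rewrite -/j; nia.
have [[rowE colE] hgtE] := coord_uniq (Ordinal j_lt) i_lt.
have [[g1 r1] ro] := gauge_row (Ordinal j_lt).
rewrite /arrow g1 r1 mul1g mul1g [(f * _)%R]mulrC.
have -> : rep (j%:Z + i%:Z * f)%R = vy ^z i%:Z.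
  by rewrite /rep colE hgtE mulg1.
rewrite mulgV psi1 (hom1 (inB_hom _)) mul1g invgK /gauge colE rowE /=.
congr inF; rewrite /fgen -divn_eq insubT //= => o_lt.
by congr pgen; apply: val_inj.
Qed.

End Decomposition.

Theorem kernel_decomposition (r n : nat) (s f A : int) (n_gt0 : (0 < n)%N)
    (D i0 m : nat) (f1 al kap : int) (B : groupType)
    (emb : B -> vertex_group r m s al) :
  n = (D * i0 * m)%N -> f = (D%:Z * f1)%R -> A = ((D * i0)%N%:Z * al)%R ->
  (i0%:Z %| (kap * f1 - 1)%R)%Z -> (n%:Z %| (f * (r%:Z - s))%R)%Z ->
  {morph emb : b c / b * c} -> injective emb ->
  (forall h, deg n f D i0 h = 1 <-> exists b, emb b = h) ->
  group_iso (classM_group n_gt0 r s f A)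
    (free_prod2 (free_prod (fun _ : 'I_D => B)) (free_group (D * i0 - D))).
Proof.
move=> n_eq f_eq A_eq kapP f_rs emb_hom emb_inj kerP.
have /choice[psi psiK] : forall h, exists b, deg n f D i0 h = 1 -> emb b = h.
  move=> h; have [/kerP[b bh]|h_neq1] := pselect (deg n f D i0 h = 1).
    by exists b.
  by exists 1.
have deg_emb b : deg n f D i0 (emb b) = 1 by apply/kerP; exists b.
apply: group_iso_of_inverse_homs.
- exact: (to_fp_hom n_eq f_eq A_eq kapP f_rs emb_hom emb_inj psiK).
- exact: (to_fpK n_eq f_eq A_eq kapP f_rs emb_hom emb_inj deg_emb psiK).
exact: (of_fpK n_gt0 n_eq f_eq A_eq kapP f_rs emb_hom emb_inj deg_emb psiK).
Qed.

(** * Congruences *)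
Section Congruences.
Local Open Scope ring_scope.
Variable d : int.

Lemma eqmodM a b c e : (a = b %[mod d])%Z -> (c = e %[mod d])%Z ->
  (a * c = b * e %[mod d])%Z.
Proof. by move=> ab ce; rewrite -modzMm ab ce modzMm. Qed.

Lemma eqmodD a b c e : (a = b %[mod d])%Z -> (c = e %[mod d])%Z ->
  (a + c = b + e %[mod d])%Z.
Proof. by move=> ab ce; rewrite -modzDm ab ce modzDm. Qed.

Lemma eqmodX a b k : (a = b %[mod d])%Z -> (a ^+ k = b ^+ k %[mod d])%Z.
Proof. by move=> ab; rewrite -modzXm ab modzXm. Qed.

Lemma eqmod_sum (I : Type) (l : seq I) (P : pred I) (F F' : I -> int) :
  (forall i, P i -> F i = F' i %[mod d])%Z ->
  (\sum_(i <- l | P i) F i = \sum_(i <- l | P i) F' i %[mod d])%Z.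
Proof.
move=> FF'; pose K a b := (a = b %[mod d])%Z.
by apply: (big_ind2 K) => // a b c e; apply: eqmodD.
Qed.

Lemma eqmod_dvd a b : (a = b %[mod d])%Z <-> (d %| a - b)%Z.
Proof. by rewrite -eqz_mod_dvd; split=> /eqP. Qed.

(** Exponents of a unit of finite order may be compared modulo that order. *)
Lemma eqmodX_period u m k l : (u ^+ m = 1 %[mod d])%Z ->
  (m%:Z %| k%:Z - l%:Z)%Z -> (u ^+ k = u ^+ l %[mod d])%Z.
Proof.
move=> um1.
have per a q : (u ^+ (a + q * m) = u ^+ a %[mod d])%Z.
  rewrite exprD mulnC exprM -[RHS](congr1 (modz^~ d) (mulr1 _)).
  by apply: eqmodM => //; rewrite -[1](expr1n _ q); apply: eqmodX.
wlog kl : k l / (l <= k)%N => [gen | /dvdzP[q kE]].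
  have [/gen//|/ltnW/gen gen_lk] := leqP l k.
  by rewrite -opprB rpredN => /gen_lk.
have {}kE : (k = l + `|q|%N * m)%N by nia.
by rewrite kE per.
Qed.

End Congruences.

(** * The groups B(M, N, R, lambda) *)

Section GroupB.
Variables (M : int) (N : nat) (R lambda : int).
Hypothesis N_gt0 : (0 < N)%N.
Let q : int := (lambda * M %/ gcdz M (R - 1))%Z.
Local Notation B := (B_group M N%:Z R lambda).

Definition Ba : B := pgen _ true.
Definition Bb : B := pgen _ false.

Lemma B_lift_rels (K : groupType) (phi : bool -> K) :
  phi true ^z M = 1 -> phi false * phi true * (phi false)^-1 = phi true ^z R ->
  phi false ^z N%:Z = phi true ^z q ->
  forall w, B_rel M N%:Z R lambda w -> weval phi w = 1.
Proof.
have eval1 b : weval phi [:: (b, false)] = phi b.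
  by rewrite weval_cons weval_nil mulg1.
move=> aM conj bN _ []; rewrite !(weval_cat, weval_inv, weval_expz) !eval1 //.
  by rewrite !expgz1 expgzN expgz1 mulgA conj mulgV.
by rewrite bN mulgV.
Qed.

Lemma B_a : Ba ^z M = 1.
Proof.
have := pgen_rel (B_rel_a M N%:Z R lambda).
by rewrite weval_expz weval_cons weval_nil mulg1.
Qed.

Lemma B_conj : Bb * Ba * Bb^-1 = Ba ^z R.
Proof.
have := pgen_rel (B_rel_conj M N%:Z R lambda).
rewrite !(weval_cat, weval_inv, weval_expz) !weval_cons !weval_nil !mulg1.
by rewrite mulgA => /divg1_eq.
Qed.

Lemma B_b : Bb ^z N%:Z = Ba ^z q.
Proof.
have := pgen_rel (B_rel_b M N%:Z R lambda).
rewrite !(weval_cat, weval_inv, weval_expz) !weval_cons !weval_nil !mulg1.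
by move=> /divg1_eq.
Qed.

(** Left multiplication by b^(-1) is the only delicate case: b^N is a power of
    a, so b^(-1) is a power of a times b^(N-1). *)
Lemma B_normal_form (g : B) : exists i (k : nat), g = Ba ^z i * Bb ^+ k.
Proof.
have pow_b i k : Bb * (Ba ^z i * Bb ^+ k) = Ba ^z (R * i)%R * Bb ^+ k.+1.
  by rewrite expgzM -B_conj -expgz_conj expgS !mulgA mulgVK.
move: g; apply: pres_ind_letter => [|x _ [i [k ->]]|x _ [i [k ->]]].
- by exists 0%R, 0%N; rewrite mulg1.
- case: x; last by exists (R * i)%R, k.+1; rewrite -pow_b.
  by exists (1 + i)%R, k; rewrite expgzD mulgA.
case: x.
  by exists (-1 + i)%R, k; rewrite expgzD mulgA.
have BbV : Bb^-1 = Ba ^z (- q)%R * Bb ^+ N.-1.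
  apply: (mulIg Bb); rewrite mulVg -mulgA -expgSr prednK //.
  by rewrite -[Bb ^+ N]/(Bb ^z N%:Z) B_b -expgzD addNr.
rewrite -[pgen _ false]/Bb BbV -mulgA.
have [i' [k' ->]] : exists i' (k' : nat),
    Bb ^+ N.-1 * (Ba ^z i * Bb ^+ k) = Ba ^z i' * Bb ^+ k'.
  elim: N.-1 => [|N' [i' [k' E]]]; first by exists i, k; rewrite mul1g.
  by exists (R * i')%R, k'.+1; rewrite expgS -mulgA E pow_b.
by exists (- q + i')%R, k'; rewrite expgzD mulgA.
Qed.

End GroupB.

(** * The vertex group is metacyclic *)

Section VertexStructure.
Variables (r m : nat) (s al : int) (mu : nat) (rhat : int) (e0 : nat).
Hypothesis m_gt0 : (0 < m)%N.
Hypothesis mu_gt0 : (0 < mu)%N.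
Hypothesis mu_eq : mu = `|(r%:Z ^+ m - s ^+ m)%R|%N.
Hypothesis rhatP : ((r%:Z * rhat)%R = 1 %[mod mu%:Z])%Z.
Hypothesis e0P : (m%:Z %| (al * e0%:Z + 1)%R)%Z.

Local Notation H := (vertex_group r m s al).
Local Notation vy := (vy : H).
Local Notation vt := (vt : H).
Let u : int := (s * rhat)%R.
Let w : int := (u ^+ e0)%R.

(** Iterating y^r = tau^al y^s tau^(-al); for k = m the power of tau is trivial
    and y^(r^m) = y^(s^m) follows. *)
Lemma vy_conj_pow k :
  vy ^z (r%:Z ^+ k)%R = vt ^z (al * k%:Z)%R * vy ^z (s ^+ k)%R * vt ^z (- (al * k%:Z))%R.
Proof.
elim: k => [|k IHk]; first by rewrite !expr0 mulr0 mul1g mulg1.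
have yr : vy ^z r%:Z = vt ^z al * vy ^z s * (vt ^z al)^-1.
  by rewrite -vy_conj mulgK.
have ysr : (vy ^z (s ^+ k)%R) ^z r%:Z =
    vt ^z al * vy ^z (s ^+ k.+1)%R * (vt ^z al)^-1.
  by rewrite -expgzM mulrC expgzM yr -expgz_conj -expgzM -exprS.
rewrite exprSr expgzM IHk expgzN -expgz_conj ysr -addn1 PoszD mulrDr mulr1.
by rewrite addn1 expgzN expgzD invgM !mulgA.
Qed.

Lemma vy_mu : vy ^z mu%:Z = 1.
Proof.
have t_alm : vt ^z (al * m%:Z)%R = 1 by rewrite mulrC expgzM vt_m exp1gz.
have yd : vy ^z (r%:Z ^+ m - s ^+ m)%R = 1.
  by rewrite expgzB vy_conj_pow expgzN t_alm invg1 mul1g mulg1 mulgV.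
apply: (@eq_trans _ _ (vy ^z 0)) => //; apply: expgz_mod yd _.
by rewrite subr0 mu_eq dvdzE.
Qed.

Lemma vy_eqmod k l : (k = l %[mod mu%:Z])%Z -> vy ^z k = vy ^z l.
Proof. by move=> /eqmod_dvd; apply: expgz_mod vy_mu. Qed.

Lemma u_m : (u ^+ m = 1%R %[mod mu%:Z])%Z.
Proof.
rewrite -[1%R](expr1n _ m) -(eqmodX m rhatP) !exprMn.
apply: eqmodM => //; apply/eqmod_dvd.
by rewrite -opprB rpredN mu_eq dvdzE.
Qed.

Lemma ru : ((r%:Z * u)%R = s %[mod mu%:Z])%Z.
Proof. by rewrite /u mulrCA -[RHS](congr1 (modz^~ _) (mulr1 s)); apply: eqmodM. Qed.

(** As r is invertible modulo the order mu of y, the relation determines the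
    action of tau^al on y itself. *)
Lemma vt_conjV : vt ^z (- al)%R * vy * vt ^z al = vy ^z u.
Proof.
rewrite -[vy in LHS]expgz1 (vy_eqmod (esym rhatP)) expgzM /u.
rewrite -[vt ^z al in LHS]invgK -expgzN expgz_conj expgzN invgK.
have -> : (vt ^z al)^-1 * vy ^z r%:Z * vt ^z al = vy ^z s.
  by rewrite -mulgA vy_conj mulKg.
by rewrite expgzM.
Qed.

Lemma vt_conjV_pow k :
  vt ^z (- (al * k%:Z))%R * vy * vt ^z (al * k%:Z)%R = vy ^z (u ^+ k)%R.
Proof.
elim: k => [|k IHk]; first by rewrite mulr0 mul1g mulg1.
have -> : vy ^z (u ^+ k.+1)%R =
    vt ^z (- al)%R * vy ^z (u ^+ k)%R * (vt ^z (- al)%R)^-1.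
  by rewrite expgz_conj expgzN invgK -expgzN vt_conjV -expgzM -exprS.
rewrite -IHk -addn1 PoszD mulrDr mulr1.
by rewrite !expgzN invgK expgzD invgM !mulgA.
Qed.

(** tau is the power -e0 of tau^al, because al e0 = -1 modulo m. *)
Lemma vt_conj : vt * vy * vt^-1 = vy ^z w.
Proof.
rewrite /w -vt_conjV_pow.
have -> : vt ^z (- (al * e0%:Z))%R = vt.
  rewrite -[RHS]expgz1; apply: expgz_mod (vt_m _ _ _ _) _.
  by rewrite -opprB rpredN opprK addrC.
have -> // : vt ^z (al * e0%:Z)%R = vt^-1.
rewrite -[X in X^-1]expgz1 -expgzN; apply: expgz_mod (vt_m _ _ _ _) _.
by rewrite opprK.
Qed.

Lemma vt_conj_pow k : vt ^+ k * vy * vt ^- k = vy ^z (w ^+ k)%R.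
Proof.
elim: k => [|k IHk]; first by rewrite expg0 invg1 mul1g mulg1.
rewrite exprSr expgzM -IHk -expgz_conj -vt_conj.
by rewrite expgSr invgM !mulgA.
Qed.

Lemma vertex_normal_form (h : H) : exists i l : nat, h = vy ^+ i * vt ^+ l.
Proof.
have yX k : exists i : nat, vy ^z k = vy ^+ i.
  exists `|(k %% mu%:Z)%Z|%N; rewrite -[RHS]/(vy ^z _%:Z); apply: vy_eqmod.
  by rewrite gez0_abs ?modz_mod // modz_ge0; lia.
have pow_t i l : exists i' : nat, vt * (vy ^+ i * vt ^+ l) = vy ^+ i' * vt ^+ l.+1.
  have [i' i'E] := yX (w * i%:Z)%R; exists i'; rewrite -i'E expgzM -vt_conj.
  by rewrite -expgz_conj expgS !mulgA mulgVK.
move: h; apply: pres_ind_letter => [|b _ [i [l ->]]|b _ [i [l ->]]].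
- by exists 0%N, 0%N; rewrite mulg1.
- case: b; first by exists i.+1, l; rewrite mulgA expgS.
  by have [i' ->] := pow_t i l; exists i', l.+1.
case: b.
  have [i' i'E] := yX (i%:Z - 1)%R; exists i', l.
  rewrite -i'E expgzP mulgA; congr (_ * _).
  by rewrite -[_^-1]/(vy ^z -1) -[vy ^+ i]/(vy ^z i%:Z) expgzC.
have vtV : vt^-1 = vt ^+ m.-1.
  by apply: (mulgI vt); rewrite mulgV -expgS prednK // -[LHS](vt_m r m s al).
rewrite -[pgen _ false]/vt vtV.
elim: m.-1 i l => [|k IHk] i l; first by exists i, l; rewrite mul1g.
have [i' [l' E]] := IHk i l; have [i'' E'] := pow_t i' l'.
by exists i'', l'.+1; rewrite expgS -mulgA E E'.
Qed.


Lemma w_m : (w ^+ m = 1%R %[mod mu%:Z])%Z.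
Proof. by rewrite /w exprAC -[1%R](expr1n _ e0); apply: eqmodX u_m. Qed.

(** This is the relation of the vertex group, read in the model. *)
Lemma sw k : (m%:Z %| (al - k%:Z)%R)%Z ->
  ((s * w ^+ k)%R = r%:Z %[mod mu%:Z])%Z.
Proof.
move=> alk; rewrite -(eqmodM ru erefl) -mulrA /w -exprM -exprS.
rewrite -[RHS](congr1 (modz^~ _) (mulr1 _)); apply: eqmodM => //.
rewrite -[1%R](expr0 u); apply: eqmodX_period u_m _.
have /dvdzP[q qE] := e0P; have /dvdzP[q' q'E] := alk.
apply/dvdzP; exists (q - q' * e0%:Z)%R.
by rewrite mulrBl -qE mulrAC -q'E; lia.
Qed.

Lemma cyclic_eqmod (c : cyclic_group mu) k l :
  (k = l %[mod mu%:Z])%Z -> c ^z k = c ^z l.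
Proof.
move=> /eqmod_dvd; apply: expgz_mod.
by rewrite (cres_surj mu_gt0 c) cresXz //; apply/cres_eq1; rewrite // dvdz_mull.
Qed.

(** The split metacyclic group Z_mu : Z_m, in which y visibly has order mu. *)
Definition model_act (l : cyclic_group m) (c : cyclic_group mu) :=
  c ^z (w ^+ (l : nat))%R.

Lemma model_act1 c : model_act 1 c = c.
Proof. by rewrite /model_act expr0 expgz1. Qed.

Lemma model_actM k l c :
  model_act (k * l) c = model_act k (model_act l c).
Proof.
rewrite /model_act -expgzM -exprD; apply: cyclic_eqmod.
apply: eqmodX_period w_m _; rewrite cyclic_mulE // -eqz_mod_dvd.
by rewrite -modz_nat modz_mod addnC.
Qed.

Lemma model_act_hom l : {morph model_act l : c d / c * d}.
Proof.
move=> c d; rewrite /model_act (cres_surj mu_gt0 c) (cres_surj mu_gt0 d).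
by rewrite -cresD // !cresXz // -cresD // mulrDl.
Qed.

Definition model : groupType :=
  sdprod (GroupAction model_act1 model_actM model_act_hom).

Definition to_model : H -> model :=
  pres_lift (fun b : bool => if b then SD _ (cres mu 1) 1 else SD _ 1 (cres m 1)).

Lemma to_model_rels h : vertex_rel r m s al h ->
  weval (fun b : bool => if b then SD _ (cres mu 1) 1 else SD _ 1 (cres m 1) : model) h = 1.
Proof.
apply: vertex_lift_rels.
  rewrite -(homXz (@sdr_incl_hom _ _ _)) cresXz // mul1r.
  by have /(cres_eq1 m_gt0) -> : (m%:Z %| m%:Z)%Z by [].
rewrite -(homXz (@sdr_incl_hom _ _ _)) -!(homXz (@sdl_incl_hom _ _ _)).
rewrite !cresXz // !mul1r.
apply: (mulIg (SD _ 1 (cres m al))^-1); rewrite mulgK sd_conj /=; congr SD.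
rewrite /model_act cresXz //; apply/eq_cres; rewrite //.
apply/eqmod_dvd/esym/sw.
by rewrite -eqz_mod_dvd cresEz // modz_mod.
Qed.

Lemma vy_order k : vy ^z k = 1 -> (mu%:Z %| k)%Z.
Proof.
have toM : {morph to_model : g h / g * h} := pres_lift_hom to_model_rels.
have toM_y : to_model vy = SD _ (cres mu 1) 1 := pres_lift_gen to_model_rels true.
move=> /(congr1 to_model); rewrite (hom1 toM) (homXz toM) toM_y.
rewrite -(homXz (@sdl_incl_hom _ _ _)) cresXz // mul1r.
by move=> [/(cres_eq1 mu_gt0)].
Qed.

(** * The kernel of the degree map *)

(** The numbers are p = n/(n,f) = N i0 and M = mu/p; the exponent j0 = -f/D
    makes the degree of y^i0 tau^j0 vanish. *)

Section Kernel.
Variables (n D i0 p M N j0 : nat) (f1 kap : int).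
Hypothesis n_gt0 : (0 < n)%N.
Hypothesis n_eq : n = (D * i0 * m)%N.
Hypothesis kapP : (i0%:Z %| (kap * f1 - 1)%R)%Z.
Hypothesis p_eq : p = (N * i0)%N.
Hypothesis mu_pM : mu = (p * M)%N.
Hypothesis p_rs : (p%:Z %| (r%:Z - s)%R)%Z.
Hypothesis j0_f1 : (m%:Z %| (j0%:Z + f1)%R)%Z.
Hypothesis j0_N : (m%:Z %| (j0%:Z * N%:Z)%R)%Z.

Let f : int := (D%:Z * f1)%R.
Local Notation nu := (@deg r n s f D i0 m al).
Let b0 : H := vy ^z i0%:Z * vt ^z j0%:Z.

Let D_gt0 : (0 < D)%N. Proof. by move: n_gt0; rewrite n_eq; case: D => //; lia. Qed.
Let i0_gt0 : (0 < i0)%N. Proof. by move: n_gt0; rewrite n_eq; case: i0 => //; lia. Qed.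
Let p_gt0 : (0 < p)%N. Proof. by move: mu_gt0; rewrite mu_pM; case: p => //; lia. Qed.
Let M_gt0 : (0 < M)%N. Proof. by move: mu_gt0; rewrite mu_pM; case: M => //; lia. Qed.

Lemma f_rs : (n%:Z %| (f * (r%:Z - s))%R)%Z.
Proof.
have /dvdzP[a aE] := p_rs; have /dvdzP[b bE] := j0_f1.
have /dvdzP[c cE] := j0_N.
have N_f1 : (N%:Z * f1 = (b * N%:Z - c) * m%:Z)%R.
  by rewrite mulrBl -cE mulrAC -bE; ring.
apply/dvdzP; exists (a * (b * N%:Z - c))%R.
have -> : (f * (r%:Z - s) = D%:Z * i0%:Z * a * (N%:Z * f1))%R.
  by rewrite aE p_eq PoszM /f; ring.
by rewrite N_f1 n_eq !PoszM; ring.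
Qed.

Lemma nu_hom : {morph nu : g h / g * h}.
Proof. exact: (deg_hom n_gt0 n_eq erefl erefl kapP f_rs). Qed.

Lemma nu_normal i l :
  nu (vy ^z i * vt ^z l) = cres n (D%:Z * (f1 * i + i0%:Z * l))%R.
Proof.
rewrite nu_hom !(homXz nu_hom).
rewrite (deg_y n_gt0 n_eq erefl erefl kapP f_rs).
rewrite (deg_t n_gt0 n_eq erefl erefl kapP f_rs).
by rewrite !cresXz // -cresD // /f PoszM; congr cres; ring.
Qed.

(** Vanishing degree means f1 i + i0 l = 0 modulo i0 m; as f1 is invertible
    modulo i0, the exponent of y is a multiple of i0. *)
Lemma nu_normal_eq1 i l : nu (vy ^z i * vt ^z l) = 1 ->
  exists z, i = (i0%:Z * z)%R /\ (m%:Z %| (f1 * z + l)%R)%Z.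
Proof.
rewrite nu_normal => /(cres_eq1 n_gt0).
rewrite n_eq -mulnA !PoszM dvdz_mul2l; last by have := D_gt0; lia.
move=> /dvdzP[q qE]; have /dvdzP[k kE] := kapP.
have iE : (i = i0%:Z * (kap * (q * m%:Z - l) - k * i))%R.
  have -> : (i0%:Z * (kap * (q * m%:Z - l) - k * i) =
    kap * (q * (i0%:Z * m%:Z)) - kap * (i0%:Z * l) - (k * i0%:Z) * i)%R by ring.
  by rewrite -qE -kE; ring.
move: qE; move: (kap * _ - _)%R iE => z ->; move=> qE.
exists z; split=> //; apply/dvdzP; exists q.
have i00 : (i0%:Z != 0)%R by have := i0_gt0; lia.
by apply: (mulfI i00); rewrite -[RHS]mulrCA -qE; ring.
Qed.

Lemma m_N_f1 : (m%:Z %| (N%:Z * f1)%R)%Z.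
Proof.
have /dvdzP[b bE] := j0_f1; have /dvdzP[c cE] := j0_N.
by apply/dvdzP; exists (b * N%:Z - c)%R; rewrite mulrBl -cE mulrAC -bE; ring.
Qed.

Lemma nu_yp : nu (vy ^z p%:Z) = 1.
Proof.
have := nu_normal p%:Z 0; rewrite mulg1 => ->; apply/cres_eq1 => //.
have /dvdzP[a aE] := m_N_f1; apply/dvdzP; exists a.
rewrite mulr0 addr0 p_eq n_eq !PoszM.
rewrite (_ : f1 * _ = i0%:Z * (N%:Z * f1))%R; last by ring.
by rewrite aE; ring.
Qed.

Lemma nu_b0 : nu b0 = 1.
Proof.
rewrite nu_normal; apply/cres_eq1 => //; have /dvdzP[a aE] := j0_f1.
apply/dvdzP; exists a; rewrite n_eq !PoszM.
rewrite (_ : f1 * _ + _ = i0%:Z * (j0%:Z + f1))%R; last by ring.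
by rewrite aE; ring.
Qed.

(** r and s agree modulo p, so the power maps by which tau acts are trivial on
    < y > / < y^p >. *)
Lemma u_mod_p : (u = 1%R %[mod p%:Z])%Z.
Proof.
have p_mu a b : (a = b %[mod mu%:Z])%Z -> (a = b %[mod p%:Z])%Z.
  by move=> /eqmod_dvd ab; apply/eqmod_dvd/(dvdz_trans _ ab); rewrite mu_pM PoszM dvdz_mulr.
rewrite -(p_mu _ _ rhatP) /u; apply: eqmodM => //.
by apply/esym/eqmod_dvd.
Qed.

Lemma w_mod_p k : (w ^+ k = 1%R %[mod p%:Z])%Z.
Proof. by rewrite -(expr1n _ (e0 * k)) /w -exprM; apply: eqmodX u_mod_p. Qed.

Lemma vt_conj_int q : exists W, (W = 1%R %[mod p%:Z])%Z /\
  forall k, vt ^z q * vy ^z k * (vt ^z q)^-1 = vy ^z (k * W)%R.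
Proof.
exists (w ^+ `|(q %% m%:Z)%Z|%N)%R; split; first exact: w_mod_p.
have -> : vt ^z q = vt ^+ `|(q %% m%:Z)%Z|%N.
  rewrite -[RHS]/(vt ^z _%:Z); apply: expgz_mod (vt_m _ _ _ _) _.
  by rewrite gez0_abs ?modz_ge0 -?eqz_mod_dvd ?modz_mod //; lia.
move=> k; rewrite [(k * _)%R]mulrC expgzM -vt_conj_pow -expgz_conj //.
Qed.

(** Stated as an induction principle, so that it identifies the image of any
    homomorphism into H. An element of degree 0 is y^(i0 z) tau^l with
    l = j0 z modulo m; removing one factor b0 at a time costs conjugations by
    powers of tau, which change the exponent of y by multiples of p only. *)
Lemma kernel_ind (Q : H -> Prop) :
  Q 1 -> (forall g h, Q g -> Q h -> Q (g * h)) -> (forall g, Q g -> Q g^-1) ->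
  Q (vy ^z p%:Z) -> Q b0 -> forall h, nu h = 1 -> Q h.
Proof.
move=> Q1 QM QV Qyp Qb.
have QX g k : Q g -> Q (g ^z k).
  move=> Qg; have QXn i : Q (g ^+ i).
    by elim: i => [//|i IHi]; rewrite expgS; apply: QM.
  by case: k => i /=; [|apply: QV].
have Qypk k : (p%:Z %| k)%Z -> Q (vy ^z k).
  by move=> /dvdzP[q ->]; rewrite mulrC expgzM; apply: QX.
have main (z : nat) l : (m%:Z %| (f1 * z%:Z + l)%R)%Z ->
    Q (vy ^z (i0%:Z * z%:Z)%R * vt ^z l).
  elim: z l => [|z IHz] l.
    rewrite !mulr0 add0r mul1g => /dvdzP[q ->].
    by rewrite mulrC expgzM vt_m exp1gz.
  (* b0 is moved to the right end by conjugating y^i0 with tau^(j0 - l) *)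
  move=> ml; have [W [W1 WE]] := vt_conj_int (j0%:Z - l)%R.
  have -> : vy ^z (i0%:Z * z.+1%:Z)%R * vt ^z l =
      (vy ^z (i0%:Z * z%:Z)%R * vt ^z (l - j0%:Z)%R) *
      (vy ^z (i0%:Z * (W - 1))%R * b0).
    have -> : vy ^z (i0%:Z * (W - 1))%R * b0 = vy ^z (i0%:Z * W)%R * vt ^z j0%:Z.
      by rewrite /b0 mulgA -expgzD; congr (_ ^z _ * _); ring.
    rewrite -WE -addn1 PoszD mulrDr mulr1 (expgzD vy) -!mulgA; congr (_ * _).
    rewrite -expgzN -!expgzD mulgA -expgzD.
    have -> : (l - j0%:Z + (j0%:Z - l) = 0)%R by ring.
    have -> : (- (j0%:Z - l) + j0%:Z = l)%R by ring.
    by rewrite mul1g.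
  apply: (QM); last first.
    apply: QM Qb; apply: Qypk; apply: dvdz_mull.
    exact/eqmod_dvd.
  apply: IHz.
  rewrite (_ : _ + _ = (f1 * z.+1%:Z + l) - (j0%:Z + f1))%R; first exact: rpredB.
  by rewrite -addn1 PoszD; ring.
move=> h; have [i [l ->]] := vertex_normal_form h.
rewrite -[vy ^+ i]/(vy ^z i%:Z) -[vt ^+ l]/(vt ^z l%:Z) => /nu_normal_eq1[z [iE ml]].
have [z' zE] : exists z' : nat, z = z'%:Z.
  exists `|z|%N; rewrite gez0_abs //.
  have i0z : (0 < i0%:Z)%R by rewrite ltz_nat i0_gt0.
  by rewrite -(pmulr_rge0 _ i0z) -iE.
by rewrite iE zE; apply: main; rewrite -zE.
Qed.


Section Metacyclic.
Variables (R v v' : int).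
Hypothesis R_w : (R = (w ^+ j0)%R %[mod mu%:Z])%Z.
Hypothesis v_unit : ((v * v')%R = 1%R %[mod mu%:Z])%Z.
Let q : int := (1%R * M%:Z %/ gcdz M%:Z (R - 1))%Z.
(* the exponents of y in a^q and in b^N ([b0_pow]), for a = y^(p v) *)
Hypothesis b_powN :
  ((p%:Z * v * q)%R = (i0%:Z * \sum_(i < N) R ^+ i)%R %[mod mu%:Z])%Z.

Local Notation B := (B_group M%:Z N%:Z R 1%R).

Let N_gt0 : (0 < N)%N. Proof. by move: p_gt0; rewrite p_eq; case: N => //; lia. Qed.

Lemma b0_conj k : b0 * vy ^z k * b0^-1 = vy ^z (R * k)%R.
Proof.
rewrite /b0 invgM !mulgA -(mulgA (vy ^z i0%:Z)) -(mulgA (vy ^z i0%:Z)).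
have -> : vt ^z j0%:Z * vy ^z k * (vt ^z j0%:Z)^-1 = vy ^z (R * k)%R.
  rewrite expgz_conj [vt ^z _]/(vt ^+ j0) vt_conj_pow -expgzM.
  by apply/vy_eqmod/eqmodM.
by rewrite expgzC mulgK.
Qed.

Lemma b0_pow k :
  b0 ^+ k = vy ^z (i0%:Z * \sum_(i < k) R ^+ i)%R * vt ^z (j0%:Z * k%:Z)%R.
Proof.
elim: k => [|k IHk]; first by rewrite big_ord0 !mulr0 mulg1.
have -> : (i0%:Z * \sum_(i < k.+1) R ^+ i =
    R * (i0%:Z * \sum_(i < k) R ^+ i) + i0%:Z)%R.
  rewrite big_ord_recl expr0 mulrDr mulr1 addrC; congr (_ + _)%R.
  rewrite mulrCA; congr (_ * _)%R; rewrite mulr_sumr.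
  by apply: eq_bigr => i _; rewrite -exprS.
rewrite expgS IHk mulgA expgzD -b0_conj -addn1 PoszD mulrDr mulr1.
rewrite addrC expgzD /b0; move: (vy ^z _) (vy ^z _) (vt ^z _) (vt ^z _) => a b c d.
by rewrite invgM !mulgA !mulgVK.
Qed.

Definition B_emb : B -> H :=
  pres_lift (fun b : bool => if b then vy ^z (p%:Z * v)%R else b0).

Lemma B_emb_rels h : B_rel M%:Z N%:Z R 1%R h ->
  weval (fun b : bool => if b then vy ^z (p%:Z * v)%R else b0) h = 1.
Proof.
apply: B_lift_rels; rewrite -?expgzM.
- rewrite -(expgz0 vy); apply: vy_eqmod; apply/eqmod_dvd.
  by rewrite subr0 mu_pM PoszM mulrAC dvdz_mulr.
- by rewrite b0_conj mulrC.
rewrite (vy_eqmod b_powN) [LHS]b0_pow.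
have -> : vt ^z (j0%:Z * N%:Z)%R = 1.
  by have /dvdzP[c ->] := j0_N; rewrite mulrC expgzM vt_m exp1gz.
by rewrite mulg1.
Qed.

Lemma B_emb_hom : {morph B_emb : g h / g * h}.
Proof. exact: (pres_lift_hom B_emb_rels). Qed.

Lemma B_emb_a : B_emb (Ba _ _ _ _) = vy ^z (p%:Z * v)%R.
Proof. exact: (pres_lift_gen B_emb_rels). Qed.

Lemma B_emb_b : B_emb (Bb _ _ _ _) = b0.
Proof. exact: (pres_lift_gen B_emb_rels). Qed.

Lemma B_emb_yp : B_emb (Ba _ _ _ _ ^z v') = vy ^z p%:Z.
Proof.
rewrite (homXz B_emb_hom) B_emb_a -expgzM -mulrA.
by apply: vy_eqmod; rewrite -[in RHS](mulr1 p%:Z); apply: eqmodM.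
Qed.

(** The exponent of y modulo p, well defined because p divides r - s; it detects
    the exponent of b modulo N. *)
Definition yexp : H -> cyclic_group p :=
  pres_lift (fun b : bool => cres p (if b then 1 else 0)%R).

Lemma yexp_rels h : vertex_rel r m s al h ->
  weval (fun b : bool => cres p (if b then 1 else 0)%R) h = 1.
Proof.
apply: vertex_lift_rels; rewrite !cresXz // !(mul0r, mul1r) ?cres0 //.
by rewrite mulg1 mul1g; apply/eq_cres.
Qed.

Lemma yexp_hom : {morph yexp : g h / g * h}.
Proof. exact: (pres_lift_hom yexp_rels). Qed.

Lemma yexp_y k : yexp (vy ^z k) = cres p k.
Proof.
have yE : yexp vy = cres p 1 := pres_lift_gen yexp_rels true.
by rewrite (homXz yexp_hom) yE cresXz // mul1r.
Qed.

Lemma yexp_t k : yexp (vt ^z k) = 1.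
Proof.
have tE : yexp vt = cres p 0 := pres_lift_gen yexp_rels false.
by rewrite (homXz yexp_hom) tE cresXz // mul0r cres0.
Qed.

(** On a normal form a^i b^k the exponent of y modulo p = N i0 is i0 k, so N
    divides k and b^k is a power of a; the order of y then bounds the
    exponent of a. *)
Lemma B_emb_inj : injective B_emb.
Proof.
apply: (hom_inj B_emb_hom) => g.
have [i [k ->]] := B_normal_form N_gt0 g.
rewrite B_emb_hom (homXz B_emb_hom) (homX B_emb_hom) B_emb_a B_emb_b -expgzM => g1.
have [k' kE] : exists k', k = (k' * N)%N.
  apply/dvdnP.
  have : yexp (vy ^z (p%:Z * v * i)%R * b0 ^+ k) = 1 by rewrite g1 (hom1 yexp_hom).
  rewrite yexp_hom (homX yexp_hom) /b0 yexp_hom !yexp_y yexp_t mulg1 cresX //.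
  rewrite -cresD // => /(cres_eq1 p_gt0).
  rewrite rpredDl; last by rewrite -mulrA dvdz_mulr.
  by rewrite -PoszM dvdzE /= p_eq mulnC dvdn_pmul2l ?i0_gt0.
have bN : Bb M%:Z N R 1 ^+ k = Ba M%:Z N R 1 ^z (q * k'%:Z)%R.
  by rewrite kE mulnC expgnA -[_ ^+ N]/(_ ^z N%:Z) B_b expgzM.
have g1' : vy ^z (p%:Z * v * (i + q * k'%:Z))%R = 1.
  by rewrite mulrDr expgzD (expgzM _ _ (q * _)%R) -B_emb_a -(homXz B_emb_hom) -bN
     (homX B_emb_hom) B_emb_b.
rewrite bN -expgzD.
have /vy_order : vy ^z (p%:Z * (i + q * k'%:Z))%R = 1.
  have -> : vy ^z (p%:Z * (i + q * k'%:Z))%R =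
      (vy ^z (p%:Z * v * (i + q * k'%:Z))%R) ^z v'.
    rewrite -expgzM; apply: vy_eqmod.
    rewrite -[X in (modz X _ = _)]mulr1 -(eqmodM erefl v_unit).
    by congr modz; ring.
  by rewrite g1' exp1gz.
rewrite mu_pM PoszM dvdz_mul2l; last by have := p_gt0; lia.
by move=> /dvdzP[c ->]; rewrite mulrC expgzM B_a exp1gz.
Qed.

Lemma B_emb_image h : nu h = 1 <-> exists g, B_emb g = h.
Proof.
split=> [|[g <-]].
  move: h; apply: kernel_ind => [|_ _ [g' <-] [h' <-]|_ [g' <-]||].
  - by exists 1; rewrite (hom1 B_emb_hom).
  - by exists (g' * h'); rewrite B_emb_hom.
  - by exists g'^-1; rewrite (homV B_emb_hom).
  - by exists (Ba _ _ _ _ ^z v'); rewrite B_emb_yp.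
  by exists (Bb _ _ _ _); rewrite B_emb_b.
move: g; apply: pres_ind => [|b|g g1|g g' g1 g1'].
- by rewrite (hom1 B_emb_hom) (hom1 nu_hom).
- case: b; last by rewrite -[pgen _ _]/(Bb _ _ _ _) B_emb_b nu_b0.
  rewrite -[pgen _ _]/(Ba _ _ _ _) B_emb_a expgzM (homXz nu_hom) nu_yp.
  by rewrite exp1gz.
- by rewrite (homV B_emb_hom) (homV nu_hom) g1 invg1.
by rewrite B_emb_hom nu_hom g1 g1' mulg1.
Qed.

End Metacyclic.

(** For N = 1 one has j0 = 0 modulo m and i0 = p, so b is y^p and the kernel is
    generated by y^p alone. *)
Section Cyclic.
Hypothesis N1 : N = 1%N.

Definition cyclic_emb (c : cyclic_group M) : H := vy ^z (p%:Z * (c : nat)%:Z)%R.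

Lemma cyclic_emb_cres k : cyclic_emb (cres M k) = vy ^z (p%:Z * k)%R.
Proof.
apply: vy_eqmod; apply/eqmod_dvd; rewrite cresEz // mu_pM PoszM -mulrBr.
by apply: dvdz_mul => //; rewrite -eqz_mod_dvd modz_mod.
Qed.

Lemma cyclic_emb_hom : {morph cyclic_emb : c d / c * d}.
Proof.
move=> c d; rewrite (cres_surj M_gt0 c) (cres_surj M_gt0 d) -cresD //.
by rewrite !cyclic_emb_cres mulrDr expgzD.
Qed.

Lemma cyclic_emb_inj : injective cyclic_emb.
Proof.
apply: (hom_inj cyclic_emb_hom) => c; rewrite (cres_surj M_gt0 c) cyclic_emb_cres.
move=> /vy_order; rewrite mu_pM PoszM dvdz_mul2l; last by have := p_gt0; lia.
by move=> /(cres_eq1 M_gt0).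
Qed.

Lemma cyclic_emb_image h : nu h = 1 <-> exists c, cyclic_emb c = h.
Proof.
split=> [|[c <-]].
  move: h; apply: kernel_ind => [|_ _ [g' <-] [h' <-]|_ [g' <-]||].
  - by exists 1; rewrite (hom1 cyclic_emb_hom).
  - by exists (g' * h'); rewrite cyclic_emb_hom.
  - by exists g'^-1; rewrite (homV cyclic_emb_hom).
  - by exists (cres M 1); rewrite cyclic_emb_cres mulr1.
  exists (cres M 1); rewrite cyclic_emb_cres mulr1 /b0 p_eq N1 mul1n.
  have /dvdzP[c cE] := j0_N; rewrite N1 mulr1 in cE.
  by rewrite cE mulrC expgzM vt_m exp1gz mulg1.
by rewrite /cyclic_emb expgzM (homXz nu_hom) nu_yp exp1gz.
Qed.

End Cyclic.

End Kernel.

End VertexStructure.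

Local Close Scope group_scope.

(** * Arithmetic *)

Lemma eqmod_divisor (c d a b : int) :
  (c %| d)%Z -> (a = b %[mod d])%Z -> (a = b %[mod c])%Z.
Proof. by move=> cd /eqmod_dvd ab; apply/eqmod_dvd/(dvdz_trans cd). Qed.

Lemma coprimez_inv_mod (a : int) (N : nat) : (0 < N)%N -> coprimez a N%:Z ->
  exists b : nat, (N%:Z %| a * b%:Z - 1)%Z.
Proof.
move=> N_gt0 /eqP co; have [b [c bc]] := Bezoutz a N%:Z.
exists `|(b %% N%:Z)%Z|%N; rewrite gez0_abs; last by rewrite modz_ge0 //; lia.
have /dvdzP[q qE] : (N%:Z %| (b %% N%:Z)%Z - b)%Z.
  by rewrite -eqz_mod_dvd modz_mod.
apply/dvdzP; exists (a * q - c); move: bc; rewrite co mulrBl -mulrA -qE.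
by move=> <-; ring.
Qed.

(** Multiplication by k permutes the residues modulo N. *)
Lemma geometric_sum_permute (d rho : int) (N k : nat) :
  (0 < N)%N -> coprime k N -> (rho ^+ N = 1 %[mod d])%Z ->
  (\sum_(i < N) (rho ^+ k) ^+ i = \sum_(i < N) rho ^+ i %[mod d])%Z.
Proof.
move=> N_gt0 co rhoN.
pose h (i : 'I_N) : 'I_N := Ordinal (ltn_pmod (k * i) N_gt0).
have h_inj : injective h.
  move=> i j [hij]; apply: val_inj => /=; apply/eqP.
  rewrite -[val i](modn_small (ltn_ord i)) -[val j](modn_small (ltn_ord j)).
  wlog le_ij : i j hij / (i <= j)%N.
    by have [/= ij|/ltnW ij gen] := leqP i j; [apply | rewrite eq_sym gen].
  rewrite eq_sym eqn_mod_dvd // -(Gauss_dvdr _ (m := N) (n := k)) 1?coprime_sym //.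
  by rewrite mulnBr -eqn_mod_dvd ?leq_mul2l ?le_ij ?orbT // hij.
rewrite [in RHS](reindex_inj h_inj) /=; apply: eqmod_sum => i _.
rewrite -exprM; apply: eqmodX_period rhoN _.
by rewrite -eqz_mod_dvd !modz_nat modn_mod.
Qed.

(** With x = r^g, y = s^g and rho = y / x modulo mu, R is a power of rho with
    exponent prime to N, so the sum of the R^i is that of the rho^i, which is
    T / x^(N-1) with T = (x^N - y^N) / (x - y). Modulo p = N i0 one has y = x,
    hence T = N x^(N-1): so T = c N with c invertible modulo i0. As
    mu = |x - y| |T|, this gives (M, R - 1) = |x - y| / i0 and
    M / (M, R - 1) = |c|. Both sides of the claim are thus i0 N c / x^(N-1) when
    v is x^(-(N-1)) times the sign of c. *)
Lemma metacyclic_exponent (r : nat) (s rhat R : int) (g N i0 M mu k : nat) :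
  (0 < mu)%N -> mu = `|r%:Z ^+ (g * N) - s ^+ (g * N)|%N ->
  (r%:Z * rhat = 1 %[mod mu%:Z])%Z -> mu = (N * i0 * M)%N ->
  ((N * i0)%N%:Z %| r%:Z - s)%Z ->
  (R = (s * rhat) ^+ (g * k) %[mod mu%:Z])%Z -> coprime k N ->
  exists v v' : int, (v * v' = 1 %[mod mu%:Z])%Z /\
    ((N * i0)%N%:Z * v * (1 * M%:Z %/ gcdz M%:Z (R - 1))%Z =
     i0%:Z * \sum_(i < N) R ^+ i %[mod mu%:Z])%Z.
Proof.
move=> mu_gt0 mu_eq rhatP mu_fact p_rs R_eq co.
have [N_gt0 [i0_gt0 M_gt0]] : (0 < N)%N /\ (0 < i0)%N /\ (0 < M)%N.
  by move: mu_gt0; rewrite mu_fact !muln_gt0 => /andP[/andP[]].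
pose x := r%:Z ^+ g; pose y := s ^+ g; pose z := rhat ^+ g; pose rho := y * z.
pose T := \sum_(i < N) x ^+ (N.-1 - i) * y ^+ i; pose d := x - y.
have xz : (x * z = 1 %[mod mu%:Z])%Z.
  by rewrite -exprMn -(expr1n _ g); apply: eqmodX.
have muE : mu%:Z = `|d| * `|T|.
  by rewrite mu_eq !exprM subrXX abszE normrM.
have rhoN : (rho ^+ N = 1 %[mod mu%:Z])%Z.
  have <- : ((x * z) ^+ N = 1 %[mod mu%:Z])%Z.
    by rewrite -[RHS](congr1 (modz^~ _) (expr1n _ N)); apply: eqmodX.
  rewrite /rho !exprMn; apply/eqmodM => //; apply/eqmod_dvd.
  by rewrite -opprB rpredN dvdzE mu_eq !exprM.
have R_rho : (R = rho ^+ k %[mod mu%:Z])%Z.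
  by rewrite R_eq exprM /rho -exprMn.
have sumE : (\sum_(i < N) R ^+ i = z ^+ N.-1 * T %[mod mu%:Z])%Z.
  transitivity ((\sum_(i < N) rho ^+ i)%R %% mu%:Z)%Z.
    rewrite -(geometric_sum_permute N_gt0 co rhoN).
    by apply: eqmod_sum => i _; apply: eqmodX.
  rewrite /T mulr_sumr; apply: eqmod_sum => i _.
  have -> : z ^+ N.-1 * (x ^+ (N.-1 - i) * y ^+ i) = (x * z) ^+ (N.-1 - i) * rho ^+ i.
    have iN : N.-1 = (N.-1 - i + i)%N by rewrite subnK // -ltnS prednK.
    by rewrite {1}iN exprD /rho !exprMn; ring.
  rewrite -[LHS](congr1 (modz^~ _) (mul1r _)); apply: eqmodM => //.
  by rewrite -(expr1n _ (N.-1 - i)); apply/esym/eqmodX.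
have xy_p : (y = x %[mod (N * i0)%N%:Z])%Z.
  by apply: eqmodX; apply/esym/eqmod_dvd.
have T_p : (T = N%:Z * x ^+ N.-1 %[mod (N * i0)%N%:Z])%Z.
  have -> : N%:Z * x ^+ N.-1 = \sum_(i < N) x ^+ N.-1.
    by rewrite sumr_const card_ord -mulr_natl natz.
  apply: eqmod_sum => i _.
  have iN : N.-1 = (N.-1 - i + i)%N by rewrite subnK // -ltnS prednK.
  by rewrite {2}iN exprD; apply: eqmodM => //; apply: eqmodX.
have [c [cE c_i0]] : exists c, T = c * N%:Z /\ (c = x ^+ N.-1 %[mod i0%:Z])%Z.
  have /eqmod_dvd/dvdzP[q qE] := T_p.
  exists (q * i0%:Z + x ^+ N.-1); split.
    by rewrite -[LHS](subrK (N%:Z * x ^+ N.-1)) qE PoszM; ring.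
  by apply/eqmod_dvd; rewrite addrK dvdz_mull.
have [d1 d1E] : exists d1, d = d1 * i0%:Z.
  apply/dvdzP; have /eqmod_dvd := xy_p; rewrite -opprB rpredN.
  by apply: dvdz_trans; rewrite PoszM dvdz_mull.
have T_neq0 : T != 0.
  by apply: contraTneq mu_gt0 => T0; rewrite -ltz_nat muE T0 normr0 mulr0.
have c_neq0 : c != 0 by apply: contraNneq T_neq0 => c0; rewrite cE c0 mul0r.
have M_eq : M%:Z = `|d1| * `|c|.
  have p0 : (N * i0)%N%:Z != 0 by rewrite eqz_nat -lt0n muln_gt0 N_gt0.
  apply: (mulfI p0); rewrite -PoszM -mu_fact muE d1E cE !normrM PoszM.
  have normn (t : nat) : `|t%:Z| = t%:Z :> int by [].
  by rewrite !normn; ring.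
have i0_mu : (i0%:Z %| mu%:Z)%Z.
  by rewrite mu_fact dvdzE /= mulnAC dvdn_mull.
have cz : (c * z ^+ N.-1 = 1 %[mod i0%:Z])%Z.
  rewrite (eqmodM c_i0 erefl) -exprMn -(expr1n _ N.-1).
  exact/eqmodX/(eqmod_divisor i0_mu).
have M_mu : (M%:Z %| mu%:Z)%Z by rewrite mu_fact dvdzE /= dvdn_mull.
have gcdE : gcdz M%:Z (R - 1) = `|d1|.
  set e := gcdz _ _.
  have e_M : (e %| M%:Z)%Z := dvdz_gcdl _ _.
  have e_mu := dvdz_trans e_M M_mu.
  suff : (e %| d1)%Z && (d1 %| e)%Z.
    by rewrite !dvdzE -eqn_dvd => /eqP ed; rewrite -abszE -ed.
  apply/andP; split.
    have R1 : (R = 1 %[mod e])%Z by apply/eqmod_dvd/dvdz_gcdr.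
    have [k' kk'] : exists k' : nat, (N%:Z %| k%:Z * k'%:Z - 1)%Z.
      by apply: coprimez_inv_mod.
    have rho1 : (rho = 1 %[mod e])%Z.
      have -> : (rho = rho ^+ (k * k') %[mod e])%Z.
        apply/esym; rewrite -[X in (_ = X %[mod _])%Z](expr1 rho).
        apply: (eqmod_divisor e_mu); apply: eqmodX_period rhoN _.
        by rewrite PoszM.
      rewrite exprM -(expr1n _ k'); apply: eqmodX.
      by rewrite -R1; apply/esym/(eqmod_divisor e_mu).
    have e_d : (e %| d)%Z.
      apply/eqmod_dvd; rewrite -[x in LHS](mulr1 x).
      rewrite -(eqmodM erefl rho1) /rho mulrCA -[RHS](congr1 (modz^~ _) (mulr1 _)).
      by apply: eqmodM => //; apply: (eqmod_divisor e_mu).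
    have /eqmod_dvd/dvdzP[q qE] := cz.
    have -> : d1 = z ^+ N.-1 * (d1 * c) - q * d.
      by rewrite d1E (mulrCA q) -qE; ring.
    apply: rpredB; apply: dvdz_mull => //.
    by move: e_M; rewrite M_eq !dvdzE !abszM !absz_id.
  rewrite dvdz_gcd; apply/andP; split.
    by rewrite M_eq dvdz_mulr // dvdzE absz_id.
  have d_mu : (d %| mu%:Z)%Z by rewrite dvdzE mu_eq !exprM subrXX abszM dvdn_mulr.
  have d1_d : (d1 %| d)%Z by rewrite d1E dvdz_mulr.
  apply: (dvdz_trans d1_d); apply/eqmod_dvd.
  rewrite (eqmod_divisor d_mu R_rho) -(expr1n _ k); apply: eqmodX.
  rewrite -(eqmod_divisor d_mu xz); apply: eqmodM => //.
  by apply/esym/eqmod_dvd.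
exists (z ^+ N.-1 * Num.sg c), (x ^+ N.-1 * Num.sg c); split.
  have -> : z ^+ N.-1 * Num.sg c * (x ^+ N.-1 * Num.sg c) = (x * z) ^+ N.-1.
    by rewrite mulrACA -expr2 sqr_sg c_neq0 mulr1 -exprMn mulrC.
  by rewrite -(expr1n _ N.-1); apply: eqmodX.
have d1_gt0 : 0 < `|d1|.
  by rewrite normr_gt0; apply: contraTneq M_gt0 => d0; rewrite -ltz_nat M_eq d0 normr0 mul0r.
rewrite gcdE mul1r M_eq mulKz; last exact: lt0r_neq0.
rewrite (eqmodM erefl sumE); congr modz.
by rewrite cE {3}(numEsg c) PoszM; ring.
Qed.

Lemma coprimez_of_inv (a b d : int) : (a * b = 1 %[mod d])%Z -> coprimez a d.
Proof.
move=> /eqmod_dvd ab1; have e_a := dvdz_gcdl a d; have e_d := dvdz_gcdr a d.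
suff : (gcdz a d %| a * b - (a * b - 1))%Z by rewrite subKr dvdz1.
by apply: rpredB; [apply: dvdz_mulr | apply: dvdz_trans e_d _].
Qed.

Lemma residue_nat (d : nat) (a : int) : (0 < d)%N ->
  exists b : nat, (a = b%:Z %[mod d%:Z])%Z.
Proof.
move=> d_gt0; exists `|(a %% d%:Z)%Z|%N.
by rewrite gez0_abs ?modz_mod // modz_ge0; lia.
Qed.

(** The theorem in terms of the quotients D = (n,A,f), i0 = (n,A)/D,
    m = n/(n,A), g = (n,f)/D and N = m/g, which are free of divisions. *)
Lemma classM_decomposition (r n : nat) (s f A : int) (n_gt0 : (0 < n)%N)
    (D i0 m N g M mu : nat) (f1 al alb rhat R : int) :
  n = (D * i0 * m)%N -> m = (N * g)%N ->
  f = D%:Z * f1 -> A = (D * i0)%N%:Z * al ->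
  coprimez f1 i0%:Z -> gcdz m%:Z f1 = g%:Z ->
  (n%:Z %| f * (r%:Z - s))%Z ->
  mu = `|r%:Z ^+ m - s ^+ m|%N -> (0 < mu)%N ->
  (r%:Z * rhat = 1 %[mod mu%:Z])%Z -> (al * alb = 1 %[mod m%:Z])%Z ->
  eq_expz_mod mu (s * rhat) (f1 * alb) R -> M = (mu %/ (N * i0))%N ->
  group_iso (classM_group n_gt0 r s f A)
    (free_prod2 (free_prod (fun _ : 'I_D => B_group M%:Z N%:Z R 1))
                (free_group (D * i0 - D))) /\
  (N = 1%N -> group_iso (classM_group n_gt0 r s f A)
    (free_prod2 (free_prod (fun _ : 'I_D => cyclic_group M))
                (free_group (D * i0 - D)))).
Proof.
move=> n_eq m_eq f_eq A_eq co_f1 gcd_f1 n_rs mu_eq mu_gt0 rhatP albP R_eq M_eq.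
have [[D_gt0 i0_gt0] [N_gt0 g_gt0]] : ((0 < D)%N /\ (0 < i0)%N) /\ ((0 < N)%N /\ (0 < g)%N).
  by move: n_gt0; rewrite n_eq m_eq !muln_gt0 => /andP[/andP[-> ->] /andP[-> ->]].
have m_gt0 : (0 < m)%N by rewrite m_eq muln_gt0 N_gt0.
have [f2 f2E] : exists f2, f1 = f2 * g%:Z.
  by apply/dvdzP; rewrite -gcd_f1 dvdz_gcdr.
have g_neq0 : g%:Z != 0 by rewrite eqz_nat -lt0n.
have co_f2N : coprimez f2 N%:Z.
  move: gcd_f1; rewrite m_eq f2E PoszM -mulz_gcdl.
  rewrite -[RHS]mul1r => /(mulIf g_neq0).
  by rewrite /coprimez gcdzC => ->.
have co_f2i : coprimez f2 i0%:Z by move: co_f1; rewrite f2E coprimezMl => /andP[].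
have p_rs : ((N * i0)%N%:Z %| r%:Z - s)%Z.
  move: n_rs; rewrite f_eq f2E.
  have -> : n%:Z = (D%:Z * g%:Z) * (N * i0)%N%:Z by rewrite n_eq m_eq !PoszM; ring.
  rewrite (_ : _ * (r%:Z - s) = (D%:Z * g%:Z) * (f2 * (r%:Z - s))); last by ring.
  rewrite dvdz_mul2l; last by rewrite mulf_neq0 // eqz_nat -lt0n.
  by rewrite Gauss_dvdzr // PoszM coprimezMl ![coprimez _ f2]coprimez_sym co_f2N.
have [e0 e0E] := residue_nat (- alb) m_gt0; have [j0 j0E] := residue_nat (- f1) m_gt0.
have e0P : (m%:Z %| al * e0%:Z + 1)%Z.
  rewrite -[X in (_ %| _ + X)%Z]opprK; apply/eqmod_dvd.
  rewrite -(eqmodM (erefl (al %% m%:Z)%Z) e0E) mulrN.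
  have := eqmodM (erefl (-1 %% m%:Z)%Z) albP.
  by rewrite !mulN1r.
have j0_f1 : (m%:Z %| j0%:Z + f1)%Z.
  by move/eqmod_dvd: j0E; rewrite -rpredN opprB opprK.
have j0_N : (m%:Z %| j0%:Z * N%:Z)%Z.
  have -> : j0%:Z * N%:Z = (j0%:Z + f1) * N%:Z - f2 * m%:Z.
    by rewrite f2E m_eq PoszM; ring.
  by apply: rpredB; [apply: dvdz_mulr | apply: dvdz_mull].
have e0j0 : ((e0 * j0)%N%:Z = f1 * alb %[mod m%:Z])%Z.
  by rewrite PoszM -(eqmodM e0E j0E); congr modz; ring.
have u_m := u_m mu_eq rhatP.
have R_w : (R = ((s * rhat) ^+ e0) ^+ j0 %[mod mu%:Z])%Z.
  rewrite -exprM; move: R_eq e0j0; case: (f1 * alb) => e /= R_eq /eqmod_dvd e0j0.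
    by rewrite R_eq; apply/esym; apply: eqmodX_period u_m e0j0.
  have per : ((s * rhat) ^+ (e0 * j0 + e.+1) = 1 %[mod mu%:Z])%Z.
    rewrite -[1](expr0 (s * rhat)); apply: eqmodX_period u_m _.
    by rewrite subr0 PoszD; move: e0j0; rewrite NegzE opprK.
  rewrite -[LHS](congr1 (modz^~ _) (mulr1 R)) -(eqmodM erefl per) addnC exprD mulrA.
  by rewrite -[RHS](congr1 (modz^~ _) (mul1r _)); apply: eqmodM.
have [k kE] : exists k, (e0 * j0 = g * k)%N.
  have /dvdzP[q qE] : (m%:Z %| (e0 * j0)%N%:Z - f1 * alb)%Z by apply/eqmod_dvd.
  suff /dvdnP[k ->] : (g %| e0 * j0)%N by exists k; rewrite mulnC.
  suff : (g%:Z %| (e0 * j0)%N%:Z)%Z by [].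
  rewrite -[X in (_ %| X)%Z](subrK (f1 * alb)) qE m_eq f2E PoszM.
  by apply: rpredD; [rewrite mulrA dvdz_mull | rewrite mulrAC dvdz_mull].
have co_k : coprime k N.
  have [f2' /eqmod_dvd f2'P] := coprimez_inv_mod N_gt0 co_f2N.
  apply: (@coprimez_of_inv k%:Z (f2'%:Z * al) N%:Z).
  have k_mod : (k%:Z = f2 * alb %[mod N%:Z])%Z.
    apply/eqmod_dvd; move/eqmod_dvd: e0j0; rewrite kE m_eq f2E !PoszM.
    rewrite (_ : g%:Z * k%:Z - _ = g%:Z * (k%:Z - f2 * alb)); last by ring.
    by rewrite [N%:Z * _]mulrC dvdz_mul2l.
  rewrite (eqmodM k_mod erefl) -[RHS](congr1 (modz^~ _) (mulr1 1)).
  have -> : f2 * alb * (f2'%:Z * al) = (f2 * f2'%:Z) * (al * alb) by ring.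
  apply: eqmodM => //; apply: eqmod_divisor albP.
  by rewrite m_eq PoszM dvdz_mulr.
have mu_pM : mu = (N * i0 * M)%N.
  rewrite M_eq mulnC divnK //.
  suff : ((N * i0)%N%:Z %| r%:Z ^+ m - s ^+ m)%Z by rewrite dvdzE -mu_eq.
  by rewrite subrXX dvdz_mulr.
have mu_eq' : mu = `|r%:Z ^+ (g * N) - s ^+ (g * N)|%N by rewrite mulnC -m_eq.
have R_k : (R = (s * rhat) ^+ (g * k) %[mod mu%:Z])%Z by rewrite R_w -exprM kE.
have [v [v' [v_unit b_powN]]] :=
  metacyclic_exponent mu_gt0 mu_eq' rhatP mu_pM p_rs R_k co_k.
have [kap kapP] := coprimez_inv_mod i0_gt0 co_f1.
rewrite mulrC in kapP.
split=> [|N1].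
  apply: (kernel_decomposition n_gt0 n_eq f_eq A_eq kapP n_rs).
  - exact: (B_emb_hom mu_eq rhatP e0P mu_pM j0_N R_w b_powN).
  - exact: (B_emb_inj m_gt0 mu_gt0 mu_eq rhatP e0P n_gt0 n_eq kapP erefl mu_pM
      p_rs j0_f1 j0_N R_w v_unit b_powN).
  rewrite f_eq; exact: (B_emb_image m_gt0 mu_gt0 mu_eq rhatP e0P n_gt0 n_eq kapP
    erefl mu_pM p_rs j0_f1 j0_N R_w v_unit b_powN).
apply: (kernel_decomposition n_gt0 n_eq f_eq A_eq kapP n_rs).
- exact: (cyclic_emb_hom m_gt0 mu_gt0 mu_eq rhatP e0P n_gt0 n_eq kapP erefl mu_pM
    p_rs j0_f1 j0_N).
- exact: (cyclic_emb_inj m_gt0 mu_gt0 mu_eq rhatP e0P n_gt0 n_eq kapP erefl mu_pM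
    p_rs j0_f1 j0_N).
rewrite f_eq; exact: (cyclic_emb_image m_gt0 mu_gt0 mu_eq rhatP e0P n_gt0 n_eq kapP
  erefl mu_pM p_rs j0_f1 j0_N).
Qed.

Theorem theorem3 (r n : nat) (s f A : int) (n_gt0 : (0 < n)%N)
    (f_rs : (n%:Z %| f * (r%:Z - s))%Z)
    (coprime_rs : gcdz r%:Z s = 1) :
  let gA := gcdn n `|A|%N in
  let gf := gcdn n `|f|%N in
  let gAf := gcdn gA `|f|%N in
  let mu := `|r%:Z ^+ (n %/ gA)%N - s ^+ (n %/ gA)%N|%N in
  let alpha := (A %/ gA%:Z)%Z in
  mu <> 0%N ->
  forall rhat alphabar R : int,
  (r%:Z * rhat = 1 %[mod mu%:Z])%Z ->
  (alpha * alphabar = 1 %[mod (n %/ gA)%N%:Z])%Z ->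
  eq_expz_mod mu (s * rhat) (f * alphabar %/ gAf%:Z)%Z R ->
  let G := classM_group n_gt0 r s f A in
  let M := (gf * mu %/ n)%N in
  let N := (n * gAf %/ (gA * gf))%N in
  let Gbar := B_group M%:Z N%:Z R 1 in
  let k := (gA - gAf)%N in
  group_iso G
    (free_prod2 (free_prod (fun _ : 'I_gAf => Gbar)) (free_group k)) /\
  ((gA * gf)%N = (n * gAf)%N ->
   group_iso G
     (free_prod2 (free_prod (fun _ : 'I_gAf => cyclic_group M)) (free_group k))).
Proof.
move=> gA gf D mu alpha /eqP; rewrite -lt0n => mu_gt0 rhat alphabar R.
move=> rhatP alphabarP R_eq G M N Gbar k.
have gA_gt0 : (0 < gA)%N by rewrite gcdn_gt0 n_gt0.
have D_gt0 : (0 < D)%N by rewrite gcdn_gt0 gA_gt0.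
pose i0 := (gA %/ D)%N; pose m := (n %/ gA)%N; pose f1 := (f %/ D%:Z)%Z.
have gA_eq : gA = (D * i0)%N by rewrite mulnC divnK // dvdn_gcdl.
have n_eq : n = (gA * m)%N by rewrite mulnC divnK // dvdn_gcdl.
have f_eq : f = D%:Z * f1 by rewrite mulrC divzK // dvdzE dvdn_gcdr.
have A_eq : A = gA%:Z * alpha by rewrite mulrC divzK // dvdzE dvdn_gcdr.
have absf : `|f|%N = (D * `|f1|)%N by rewrite {1}f_eq abszM.
have co_f1 : coprime i0 `|f1|%N.
  by rewrite /coprime -(eqn_pmul2l D_gt0) muln_gcdr -gA_eq -absf muln1.
have D_dvd : (D%:Z %| f)%Z by rewrite dvdzE dvdn_gcdr.
have gfE : gf = (D * gcdn m `|f1|%N)%N.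
  rewrite /gf {1}n_eq gA_eq absf -mulnA -muln_gcdr; congr (_ * _)%N.
  by rewrite gcdnC Gauss_gcdr 1?gcdnC // coprime_sym.
pose g := gcdn m `|f1|%N; pose N' := (m %/ g)%N.
have m_eq : m = (N' * g)%N by rewrite divnK // dvdn_gcdl.
have [[_ i0_gt0] [N'_gt0 g_gt0]] :
    ((0 < D)%N /\ (0 < i0)%N) /\ ((0 < N')%N /\ (0 < g)%N).
  have := n_gt0; rewrite [X in (0 < X)%N]n_eq gA_eq m_eq !muln_gt0.
  by move=> /andP[/andP[-> ->] /andP[-> ->]].
have N_eq : N = N'.
  rewrite /N n_eq gA_eq gfE -/g m_eq.
  have -> : (D * i0 * (N' * g) * D = N' * (D * i0 * (D * g)))%N by ring.
  by rewrite mulnK // !muln_gt0 D_gt0 i0_gt0 g_gt0.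
have M_eq : M = (mu %/ (N' * i0))%N.
  rewrite /M gfE -/g; have -> : n = (D * g * (N' * i0))%N.
    by rewrite n_eq gA_eq {1}m_eq; ring.
  by rewrite divnMl // muln_gt0 D_gt0 g_gt0.
have f_alb : (f * alphabar %/ D%:Z)%Z = f1 * alphabar.
  by rewrite {1}f_eq -mulrA mulKz // eqz_nat -lt0n.
have kE : k = (D * i0 - D)%N by rewrite /k gA_eq.
have nE : n = (D * i0 * m)%N by rewrite -gA_eq.
have AE : A = (D * i0)%N%:Z * alpha by rewrite -gA_eq.
have co_f1z : coprimez f1 i0%:Z by rewrite /coprimez gcdzC; exact: co_f1.
have gcd_f1 : gcdz m%:Z f1 = g%:Z by [].
rewrite f_alb in R_eq; rewrite kE /Gbar N_eq.
have [iso iso_cyclic] := classM_decomposition n_gt0 nE m_eq f_eq AE co_f1z gcd_f1 f_rs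
  (erefl mu) mu_gt0 rhatP alphabarP R_eq M_eq.
split=> // N1; apply: iso_cyclic.
rewrite -N_eq /N -N1 divnn muln_gt0 gA_gt0.
by rewrite gfE muln_gt0 D_gt0 g_gt0.
Qed.
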